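(* Let $n\ge 4$, $S=\mathbb{C}[x_1,\dots,x_n]$, and let $a<b$ be positive integers. Put $n_0=b-a$, and let $q_1$ be the smallest prime factor of $n_0$. If $q_1>\max\{n,a\}$, then the ideal $I=\langle p_a,p_b\rangle$ is a prime ideal of $S$. Moreover, for every positive integer $c$ with $p_c\notin\langle p_a,p_b\rangle$, the polynomials $p_a,p_b,p_c$ form a regular sequence in $S$.
   Context: $p_a=\sum_{i=1}^n x_i^a$ denotes the power sum symmetric polynomial of degree $a$. A sequence $y_1,\dots,y_d$ in $S$ is a regular sequence if $\langle y_1,\dots,y_d\rangle\ne S$ and for each $i$ the image of $y_{i+1}$ is a nonzero divisor in $S/\langle y_1,\dots,y_i\rangle$. *)

(* Defs.v *)
From HB Require Import structures.
From mathcomp Require Import all_boot all_order all_algebra.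
Set Implicit Arguments. Unset Strict Implicit. Unset Printing Implicit Defensive.
Import GRing.Theory.
Local Open Scope ring_scope.

Fixpoint mpoly (F : idomainType) (n : nat) : idomainType :=
  match n with
  | 0 => F
  | n'.+1 => ({poly mpoly F n'} : idomainType)
  end.

(* The variable x_{i+1} (0 <= i < n) of mpoly F n; out-of-range indices give 0. *)
Fixpoint mvar (F : idomainType) (n : nat) : nat -> mpoly F n :=
  match n return nat -> mpoly F n with
  | 0 => fun _ => 0
  | n'.+1 => fun i => if i == n' then ('X : {poly mpoly F n'})
                      else ((mvar F n' i)%:P : {poly mpoly F n'})
  end.

Definition psum (F : idomainType) (n a : nat) : mpoly F n :=
  \sum_(i < n) mvar F n i ^+ a.

Definition in_ideal (R : comRingType) (gs : seq R) (f : R) : Prop :=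
  exists cs : seq R, size cs = size gs /\
    f = \sum_(i < size gs) cs`_i * gs`_i.

Definition prime_ideal (R : comRingType) (gs : seq R) : Prop :=
  ~ in_ideal gs 1 /\
  forall f g : R, in_ideal gs (f * g) -> in_ideal gs f \/ in_ideal gs g.

Definition regular_seq (R : comRingType) (ys : seq R) : Prop :=
  ~ in_ideal ys 1 /\
  forall i : nat, (i < size ys)%N ->
    forall f : R, in_ideal (take i ys) (ys`_i * f) -> in_ideal (take i ys) f.

(* Main.v *)
(* Let [R = S/I] with [I = (p_a, p_b)].  A singular point of [V(I)] outside the origin would
   have all its nonzero coordinates equal up to [b-a]-th roots of unity, so it would yield a
   vanishing sum of at most [n < q_1] such roots; Galois conjugation then makes their first
   [n] power sums vanish, which is impossible.  Hence [V(I)] is smooth outside the origin,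
   and since [n >= 4] the ring [R] has depth at least 2.

   Instead of Serre's criterion we use idempotents.  Suppose [f g = 0] in [R].  As [R] is
   reduced, [J = Ann(f) + Ann(Ann(f))] is stable under the derivations given by the 3x3
   Jacobian determinants with two gradient rows [grad p_a], [grad p_b].  Integrality of [f]
   over [F[x_1..x_(n-2)]] puts a nonzero polynomial in these variables in [J];
   differentiating it down to a constant puts a power of a 2x2 Jacobian minor in [J], and by
   symmetry a power of each of them.  So smoothness gives powers [s^N], [t^M] of the last two
   variables in [J].  They form a regular sequence on [R], which turns the two decompositions
   into an idempotent [e] of [R]; [R] is graded and connected, so [e] is 0 or 1, i.e. [f = 0]
   or [g = 0].

   Reducedness comes from hyperplane sections: the sections [x_n = 0] go down to [n = 4],
   where the section [x_4 = w x_3] with [w^a = -1] has an explicit reduced coordinate ring.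
   Both this and the explicit elimination of a variable use that [a] and [b] have opposite
   parities, [b - a] being odd. *)
Require Import Defs.
From HB Require Import structures.
From mathcomp Require Import all_boot all_order all_fingroup all_algebra all_solvable all_field.
From mathcomp Require Import boolp ring zify.
Set Implicit Arguments. Unset Strict Implicit. Unset Printing Implicit Defensive.
Import GRing.Theory.
Local Open Scope ring_scope.
Local Open Scope quotient_scope.

(** * Quotients, and evaluation and partial derivatives of iterated polynomials *)

Lemma quotient_exists (S : comNzRingType) (I : S -> Prop) :
    (forall u v, I u -> I v -> I (u + v)) -> (forall u v, I v -> I (u * v)) ->
    I 0 -> ~ I 1 ->
  exists (Q : comNzRingType) (pi : {rmorphism S -> Q}) (r : Q -> S),
    (forall f, pi f = 0 <-> I f) /\ cancel r pi.
Proof.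
move=> ID IM I0 I1.
pose J : pred S := fun f => `[< I f >].
have Jc : idealr_closed J.
  split; first exact/asboolP.
    by apply/negP => /asboolP.
  by move=> u v w /asboolP Iv /asboolP Iw; apply/asboolP/ID => //; apply: IM.
pose HJ := isIdealr.Build _ _ Jc.
pose K : idealr S := HB.pack J HJ.
pose p : {rmorphism S -> {ideal_quot K}} := \pi_{ideal_quot K}.
have pE f : (p f == 0) = (f \in K).
  by rewrite -(rmorph0 p) -[f in RHS]subr0 Quotient.idealrBE.
exists {ideal_quot K}, p, generic_quotient.repr; split; last exact: reprK.
by move=> f; split=> [/eqP|If]; [|apply/eqP]; rewrite pE => *; apply/asboolP.
Qed.

Fixpoint mconst (F : idomainType) (n : nat) : {rmorphism F -> mpoly F n} :=
  match n with
  | 0 => idfun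
  | n'.+1 => (polyC \o mconst F n' : {rmorphism F -> {poly mpoly F n'}})
  end.

Fixpoint meval (F : idomainType) (T : comNzRingType) (h : {rmorphism F -> T})
    (v : nat -> T) (n : nat) : {rmorphism mpoly F n -> T} :=
  match n with
  | 0 => h
  | n'.+1 => (horner_morph (fun p => mulrC (v n') (meval h v n' p))
               : {rmorphism {poly mpoly F n'} -> T})
  end.

Lemma mevalS (F : idomainType) (T : comNzRingType) (h : {rmorphism F -> T}) v n (p : {poly mpoly F n}) :
  meval h v n.+1 p = (map_poly (meval h v n) p).[v n].
Proof. by []. Qed.

Lemma mvarS (F : idomainType) n i : (i < n)%N ->
  mvar F n.+1 i = (mvar F n i)%:P :> {poly mpoly F n}.
Proof. by move=> lt_in /=; rewrite ltn_eqF. Qed.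

Lemma mvar_last (F : idomainType) n : mvar F n.+1 n = 'X :> {poly mpoly F n}.
Proof. by rewrite /= eqxx. Qed.

Lemma meval_var (F : idomainType) (T : comNzRingType) (h : {rmorphism F -> T}) v n i :
  (i < n)%N -> meval h v n (mvar F n i) = v i.
Proof.
elim: n => // n IHn; rewrite ltnS leq_eqVlt => /predU1P[->|lt_in].
  by rewrite mvar_last mevalS map_polyX hornerX.
by rewrite mvarS // mevalS map_polyC hornerC; apply: IHn.
Qed.

Lemma meval_const (F : idomainType) (T : comNzRingType) (h : {rmorphism F -> T}) v n c :
  meval h v n (mconst F n c) = h c.
Proof. by elim: n => // n IHn; rewrite mevalS map_polyC hornerC; apply: IHn. Qed.

Lemma mpoly_ind (F : idomainType) n (P : mpoly F n -> Prop) :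
    (forall c, P (mconst F n c)) -> (forall i, (i < n)%N -> P (mvar F n i)) ->
    (forall u v, P u -> P v -> P (u + v)) -> (forall u v, P u -> P v -> P (u * v)) ->
  forall f, P f.
Proof.
elim: n P => [|n IHn] P Pc Px PD PM; first exact: Pc.
have PC (c : mpoly F n) : P (c%:P : {poly mpoly F n}).
  apply: (IHn (fun c => P (c%:P : {poly mpoly F n}))) => [d|i lt_in|u v Pu Pv|u v Pu Pv].
  - exact: Pc.
  - by have := Px i (ltnW lt_in); rewrite mvarS.
  - by rewrite polyCD; apply: PD.
  - by rewrite polyCM; apply: PM.
move=> f; elim/poly_ind: (f : {poly mpoly F n}) => [|p c Pp]; first exact: PC.
by apply: PD => //; apply: PM => //; have := Px n (leqnn _); rewrite mvar_last.
Qed.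

Lemma mpoly_ext (F : idomainType) n (T : nzRingType) (g h : {rmorphism mpoly F n -> T}) :
    (forall c, g (mconst F n c) = h (mconst F n c)) ->
    (forall i, (i < n)%N -> g (mvar F n i) = h (mvar F n i)) ->
  g =1 h.
Proof.
move=> eqc eqx; apply: mpoly_ind => // u v eu ev.
  by rewrite !rmorphD eu ev.
by rewrite !rmorphM eu ev.
Qed.

Definition derivation (R : comNzRingType) (D : R -> R) :=
  (forall u v, D (u + v) = D u + D v) /\ (forall u v, D (u * v) = D u * v + u * D v).

Fixpoint mderiv (F : idomainType) (n i : nat) : {additive mpoly F n -> mpoly F n} :=
  match n return {additive mpoly F n -> mpoly F n} with
  | 0 => (\0 : {additive F -> F})
  | n'.+1 => if i == n' then (@deriv (mpoly F n') : {additive {poly mpoly F n'} -> _})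
             else (map_poly (mderiv F n' i) : {additive {poly mpoly F n'} -> _})
  end.

Lemma mderiv_last (F : idomainType) n (p : {poly mpoly F n}) :
  mderiv F n.+1 n p = p^`() :> {poly mpoly F n}.
Proof. by rewrite /= eqxx. Qed.

Lemma mderivS (F : idomainType) n i (p : {poly mpoly F n}) : (i < n)%N ->
  mderiv F n.+1 i p = map_poly (mderiv F n i) p :> {poly mpoly F n}.
Proof. by move=> lt_in; rewrite /= ltn_eqF. Qed.

Lemma mderiv_const (F : idomainType) n i c : mderiv F n i (mconst F n c) = 0.
Proof.
elim: n => [|n IHn] //=; case: eqP => _ /=; first exact: derivC.
by rewrite map_polyC IHn.
Qed.

Lemma mderiv_var (F : idomainType) n i j : (i < n)%N -> (j < n)%N ->
  mderiv F n i (mvar F n j) = (i == j)%:R.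
Proof.
elim: n => // n IHn; rewrite !ltnS [in X in X -> _]leq_eqVlt [in X in _ -> X -> _]leq_eqVlt.
move=> /predU1P[->|lt_in] /predU1P[->|lt_jn].
- by rewrite mvar_last mderiv_last derivX eqxx.
- by rewrite mvarS // mderiv_last derivC gtn_eqF.
- rewrite mvar_last mderivS // ltn_eqF //; apply/polyP => k; rewrite coef_map coefX coef0.
  by case: eqP => _; rewrite ?raddf0 // -(rmorph1 (mconst F n)) mderiv_const.
- by rewrite mvarS // mderivS // map_polyC IHn // rmorph_nat.
Qed.

Lemma mderivM (F : idomainType) n i (u v : mpoly F n) :
  mderiv F n i (u * v) = mderiv F n i u * v + u * mderiv F n i v.
Proof.
elim: n u v => [|n IHn] u v; first by rewrite /= mul0r mulr0 addr0.
move: (u : {poly mpoly F n}) (v : {poly mpoly F n}) => {u v} p q /=.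
case: eqP => _; first exact: derivM.
apply/polyP => k; rewrite coefD !coefM coef_map coefM raddf_sum -big_split /=.
by apply: eq_bigr => j _; rewrite IHn !coef_map.
Qed.

(** * Graded quotients, annihilators and derivations *)

(** This sends [x_i] to [pi(x_i) T], so the coefficient of [T^k] is the image of the homogeneous
    component of degree [k]. If it kills the kernel of [pi], then [R] inherits the grading. *)
Definition grading (F : idomainType) (n : nat) (R : comNzRingType)
    (pi : {rmorphism mpoly F n -> R}) : {rmorphism mpoly F n -> {poly R}} :=
  meval (polyC \o (pi \o mconst F n)) (fun i => (pi (mvar F n i))%:P * 'X) n.

Lemma grading_horner1 (F : idomainType) n (R : comNzRingType)
    (pi : {rmorphism mpoly F n -> R}) f : (grading pi f).[1] = pi f.
Proof.
pose g : {rmorphism mpoly F n -> R} := horner_eval 1 \o grading pi.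
apply: (mpoly_ext (g := g)) => [c|i lt_in]; rewrite /g /= /grading /horner_eval.
  by rewrite meval_const /= hornerC.
by rewrite meval_var //= hornerM hornerX hornerC mulr1.
Qed.

Lemma grading_coef0 (F : idomainType) n (R : comNzRingType)
    (pi : {rmorphism mpoly F n -> R}) f :
  (grading pi f)`_0 = pi (mconst F n (meval (GRing.RMorphism.clone _ _ idfun _) (fun=> 0) n f)).
Proof.
rewrite -horner_coef0.
pose g : {rmorphism mpoly F n -> R} := horner_eval 0 \o grading pi.
pose h : {rmorphism mpoly F n -> R} :=
  pi \o (mconst F n \o meval (GRing.RMorphism.clone F F idfun _) (fun=> 0) n).
apply: (mpoly_ext (g := g) (h := h)) => [c|i lt_in]; rewrite /g /h /= /grading /horner_eval.
  by rewrite !meval_const /= hornerC.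
by rewrite !meval_var //= hornerM hornerX mulr0 !rmorph0.
Qed.

Lemma idempotent_poly_eq0 (R : comNzRingType) (E : {poly R}) :
  E * E = E -> E`_0 = 0 -> E = 0.
Proof.
move=> EE E0; suff Ek k : E`_k = 0 by apply/polyP => k; rewrite Ek coef0.
elim/ltn_ind: k => k IHk; case: k IHk => // k IHk.
rewrite -EE coefM big1 // => -[i /= lti] _.
move: lti; rewrite ltnS leq_eqVlt => /predU1P[->|lti].
  by rewrite subnn E0 mulr0.
by rewrite IHk ?mul0r.
Qed.

(** The constant term of [e] is an idempotent of the field [F], so it is 0 or 1. In the first case
    [idempotent_poly_eq0] applies to the grading image of a representative of [e]; in the second, to
    that of [1 - e]. *)
Lemma graded_idempotent (F : fieldType) n (R : comNzRingType)
    (pi : {rmorphism mpoly F n -> R}) (r : R -> mpoly F n) :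
    cancel r pi -> (forall f, pi f = 0 -> grading pi f = 0) ->
  forall e : R, e * (1 - e) = 0 -> e = 0 \/ e = 1.
Proof.
move=> rK pi0 e ee.
pose z := meval (GRing.RMorphism.clone F F idfun _) (fun=> 0) n.
have idem f : pi f * (1 - pi f) = 0 -> grading pi f * grading pi f = grading pi f.
  move=> H; apply/eqP; rewrite -subr_eq0 -rmorphM -rmorphB; apply/eqP/pi0.
  rewrite rmorphB rmorphM.
  have -> : pi f * pi f - pi f = - (pi f * (1 - pi f)) by ring.
  by rewrite H oppr0.
have zero f : pi f * (1 - pi f) = 0 -> z f = 0 -> pi f = 0.
  move=> /idem EE zf0; rewrite -grading_horner1 (idempotent_poly_eq0 EE) ?horner0 //.
  by rewrite grading_coef0 -/z zf0 !rmorph0.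
have : z (r e) * (1 - z (r e)) = 0.
  have H : pi (r e) * (1 - pi (r e)) = 0 by rewrite rK.
  have /(congr1 (fun p : {poly R} => p`_0)) := idem _ H.
  rewrite coef0M !grading_coef0 -/z; set c := z _; clearbody c.
  rewrite -!rmorphM => /eqP.
  rewrite -subr_eq0 -!rmorphB -[pi _]/((pi \o mconst F n) _) fmorph_eq0 subr_eq0 => /eqP cc.
  by rewrite mulrBr mulr1 cc subrr.
move/eqP; rewrite mulf_eq0 => /orP[/eqP z0|].
  by left; rewrite -(rK e); apply: zero => //; rewrite rK.
rewrite subr_eq0 eq_sym => /eqP z1; right; apply/eqP; rewrite eq_sym -subr_eq0; apply/eqP.
have <- : pi (1 - r e) = 1 - e by rewrite rmorphB rmorph1 rK.
apply: zero; rewrite ?rmorphB ?rmorph1 ?z1 ?subrr // rK.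
by rewrite opprB addrCA subrr addr0 mulrC.
Qed.

(** A graded form of Krull's intersection theorem: since [t] is homogeneous of degree 1,
    divisibility by [t ^+ k.+1] kills the component of degree [k]. *)
Lemma graded_separated (F : fieldType) n (R : comNzRingType)
    (pi : {rmorphism mpoly F n -> R}) (t : mpoly F n) :
    (forall f, pi f = 0 -> grading pi f = 0) -> grading pi t = (pi t)%:P * 'X ->
  forall f, (forall k, exists h, pi f = pi (t ^+ k * h)) -> pi f = 0.
Proof.
move=> pi0 gt f Hf; rewrite -grading_horner1.
suff -> : grading pi f = 0 by rewrite horner0.
apply/polyP => k; rewrite coef0.
have [h /eqP] := Hf k.+1; rewrite -subr_eq0 -rmorphB => /eqP/pi0/eqP.
rewrite rmorphB rmorphM rmorphXn subr_eq0 gt => /eqP ->.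
by rewrite exprMn mulrAC coefMXn ltnS leqnn.
Qed.

(** The ideal [Ann(Ann(f)) + Ann(f)], with [h1] in the first summand and [h2] in the second. *)
Definition ann_sum (R : comNzRingType) (f h : R) :=
  exists h1 h2, [/\ forall g, g * f = 0 -> h1 * g = 0, h2 * f = 0 & h = h1 + h2].

Lemma ann_sumD (R : comNzRingType) (f u v : R) :
  ann_sum f u -> ann_sum f v -> ann_sum f (u + v).
Proof.
move=> [u1 [u2 [Hu1 Hu2 ->]]] [v1 [v2 [Hv1 Hv2 ->]]].
exists (u1 + v1), (u2 + v2); split; last by rewrite addrACA.
  by move=> g gf; rewrite mulrDl Hu1 ?Hv1 ?addr0.
by rewrite mulrDl Hu2 Hv2 addr0.
Qed.

Lemma ann_sumM (R : comNzRingType) (f u v : R) : ann_sum f v -> ann_sum f (u * v).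
Proof.
move=> [v1 [v2 [Hv1 Hv2 ->]]]; exists (u * v1), (u * v2); split; last exact: mulrDr.
  by move=> g gf; rewrite -mulrA Hv1 ?mulr0.
by rewrite -mulrA Hv2 mulr0.
Qed.

(** From [D(g f) = 0], the square of [D(g) f] is a multiple of [g f], so [Ann(f)] is stable under
    [D] in a reduced ring. Then [D(h1 g) = 0] shows the same for [Ann(Ann(f))]. *)
Lemma ann_sum_derivation (R : comNzRingType) (D : R -> R) (f h : R) :
    (forall x : R, x * x = 0 -> x = 0) -> derivation D ->
  ann_sum f h -> ann_sum f (D h).
Proof.
move=> red [DD DM] [h1 [h2 [H1 H2 ->]]]; rewrite DD.
have D0 : D 0 = 0 by apply: (addrI (D 0)); rewrite -DD !addr0.
have ann_stable g : g * f = 0 -> D g * f = 0.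
  move=> gf; apply: red; have := DM g f; rewrite gf D0 => E.
  have -> : D g * f * (D g * f) = (D g * f + g * D f) * (D g * f) - D g * D f * (g * f) by ring.
  by rewrite -E gf; ring.
exists (D h1), (D h2); split=> //; last exact: ann_stable.
move=> g gf; have := DM h1 g; rewrite (H1 _ gf) D0 (H1 _ (ann_stable _ gf)) addr0.
by move=> <-.
Qed.

(** Write [s ^+ N = al + be] and [t ^+ M = al' + be']. As [al be' = be al' = 0], one gets
    [t ^+ M * al = s ^+ N * al'], and regularity gives [al = s ^+ N * e]. Then
    [be = s ^+ N * (1 - e)], and [al * be = 0] makes [e] idempotent. *)
Lemma domain_of_connected (R : comNzRingType) (s t f g : R) N M :
    (forall x, s * x = 0 -> x = 0) -> (forall x y, t * x = s * y -> exists z, x = s * z) ->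
    (forall e : R, e * (1 - e) = 0 -> e = 0 \/ e = 1) ->
    ann_sum f (s ^+ N) -> ann_sum f (t ^+ M) -> f * g = 0 ->
  f = 0 \/ g = 0.
Proof.
move=> s_reg t_reg idem [al [be [Hal Hbe Es]]] [al' [be' [Hal' Hbe' Et]]] fg.
have sN k x : s ^+ k * x = 0 -> x = 0.
  by elim: k x => [|k IHk] x; rewrite ?mul1r // exprS -mulrA => /s_reg/IHk.
have tsN k x y : t ^+ k * x = s * y -> exists z, x = s * z.
  elim: k y => [|k IHk] y; first by rewrite mul1r => ->; exists y.
  by rewrite exprS -mulrA => /t_reg[z]; apply: IHk.
have tN k m x y : t ^+ k * x = s ^+ m * y -> exists z, x = s ^+ m * z.
  elim: m x y => [|m IHm] x y E; first by exists x; rewrite mul1r.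
  have [z Ez] : exists z, x = s * z by apply: (tsN k _ (s ^+ m * y)); rewrite mulrA -exprS.
  have /IHm[w Ew] : t ^+ k * z = s ^+ m * y.
    apply/eqP; rewrite -subr_eq0; apply/eqP/s_reg.
    by rewrite mulrBr mulrCA -Ez E exprS mulrA subrr.
  by exists w; rewrite Ez Ew exprS mulrA.
have [e Ee] : exists e, al = s ^+ N * e.
  apply: (tN M _ _ al'); rewrite Et Es mulrDl mulrDl [be' * al]mulrC (Hal _ Hbe').
  by rewrite [be * al']mulrC (Hal' _ Hbe) !addr0 mulrC.
have Eb : be = s ^+ N * (1 - e) by rewrite mulrBr -Ee mulr1 Es [al + be]addrC addrK.
have : e * (1 - e) = 0.
  by apply/(sN N)/(sN N); rewrite -(Hal _ Hbe) Ee Eb; ring.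
case/idem => ee.
  left; apply: (sN N); rewrite -[RHS]Hbe; congr (_ * _).
  by rewrite Eb ee subr0 mulr1.
right; apply: (sN N); rewrite -(Hal g) ?[g * f]mulrC //; congr (_ * _).
by rewrite Ee ee mulr1.
Qed.

(* From [D(g D^r) D - r g D^r D(D)]: each differentiation lowers a degree of [d] at the
   price of two more powers of [De]. *)
Lemma derivation_elim (F : fieldType) (m : nat) (R : comNzRingType) (J : R -> Prop)
    (De : R) (iota : {rmorphism mpoly F m -> R}) :
    [pchar F] =i pred0 ->
    (forall u v, J u -> J v -> J (u + v)) -> (forall u v, J v -> J (u * v)) ->
    (forall k, (k < m)%N -> exists D, [/\ derivation D, forall h, J h -> J (D h)
       & forall d, D (iota d) = De * iota (mderiv F m k d)]) ->
  forall (d : mpoly F m) r, d != 0 -> J (iota d * De ^+ r) -> exists N, J (De ^+ N).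
Proof.
move=> charF JD JM.
elim: m iota => [|m IHm] iota HD d r dn0 Jd.
  exists r; have -> : De ^+ r = iota d^-1 * (iota d * De ^+ r).
    by rewrite mulrA -rmorphM mulVf // rmorph1 mul1r.
  exact: JM.
have [sz] := ubnP (size (d : {poly mpoly F m})).
elim: sz d r dn0 Jd => // sz IHsz d r dn0 Jd; rewrite ltnS => ltsz.
have [sz1|sz2] := leqP (size (d : {poly mpoly F m})) 1.
  have Ed := size1_polyC sz1.
  pose iota' : {rmorphism mpoly F m -> R} := iota \o (polyC : mpoly F m -> {poly mpoly F m}).
  apply: (IHm iota' _ ((d : {poly mpoly F m})`_0) r).
  - move=> k ltk; have [D [D1 D2 D3]] := HD k (ltnW ltk); exists D; split=> // c.
    rewrite /iota' /=; rewrite D3; congr (_ * iota _).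
    by have := mderivS (c%:P) ltk => ->; rewrite map_polyC.
  - by apply: contra dn0 => /eqP E; rewrite Ed E.
  - by rewrite /iota' /= -Ed.
have [D [[DD DM] D2 D3]] := HD m (leqnn _).
have DX u k : D (u ^+ k) * u = k%:R * (u ^+ k * D u).
  elim: k => [|k IHk].
    have /(congr1 (fun x => x - D 1)) : D 1 = D 1 + D 1.
      by rewrite -{1}[1]mulr1 DM mulr1 mul1r.
    by rewrite subrr addrK expr0 => <-; rewrite !mul0r.
  by rewrite exprS DM mulrDl -[u * D _ * u]mulrA IHk -natr1; ring.
have D1 := D3 d.
rewrite (mderiv_last (d : {poly mpoly F m})) in D1.
apply: (IHsz ((d : {poly mpoly F m})^`()) r.+2).
- have : lead_coef (d : {poly mpoly F m}) != 0 by rewrite lead_coef_eq0.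
  apply: contra => /eqP/(congr1 (fun p : {poly mpoly F m} => p`_(size (d : {poly mpoly F m})).-2)).
  move=> /eqP; rewrite coef_deriv coef0 lead_coefE.
  have -> : ((size (d : {poly mpoly F m})).-2).+1 = (size (d : {poly mpoly F m})).-1.
    by case: (size _) sz2 => [|[|k]].
  rewrite -mulr_natr mulf_eq0 => /orP[//|].
  rewrite -(rmorph_nat (mconst F m)) fmorph_eq0 => /eqP k0; exfalso.
  have := (pcharf0P F).1 charF (size (d : {poly mpoly F m})).-1.
  by rewrite k0 eqxx; case: (size _) sz2 => [|[|k]].
- have -> : iota ((d : {poly mpoly F m})^`() : mpoly F m.+1) * De ^+ r.+2
      = De * D (iota d * De ^+ r) - (r%:R * D De) * (iota d * De ^+ r).
    rewrite DM D1 mulrDr [De * (iota d * _)]mulrCA [De * D _]mulrC DX !exprS; ring.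
  apply: JD; first exact/JM/D2.
  by rewrite -mulNr; apply: JM.
- by apply: leq_trans ltsz; apply: lt_size_deriv.
Qed.

(** * Vanishing sums of roots of unity *)

Lemma closed_prim_root_exists (F : closedFieldType) (n : nat) :
  [pchar F] =i pred0 -> (0 < n)%N -> exists z : F, n.-primitive_root z.
Proof.
move=> charF n_gt0; pose p : {poly F} := 'X^n - 1; have [r Dp] := closed_field_poly_normal p.
rewrite (monicP _) ?monicXnsubC // scale1r in Dp.
have rn1: all n.-unity_root r by apply/allP=> z; rewrite -root_prod_XsubC -Dp.
have sz_r: (n < (size r).+1)%N.
  by rewrite -(size_prod_XsubC r id) -Dp size_XnsubC.
have [|z] := hasP (has_prim_root n_gt0 rn1 _ sz_r); last by exists z.
by rewrite -separable_prod_XsubC -Dp separable_Xn_sub_1 // (pcharf0P F).1 // -lt0n.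
Qed.

Lemma intr_char0_eq0 (F : fieldType) (c : int) :
  [pchar F] =i pred0 -> (c%:~R == 0 :> F) = (c == 0).
Proof.
move=> /(pcharf0P F).1 charF; case: c => k; first exact: charF.
by rewrite NegzE rmorphN oppr_eq0 /= [_ == 0]charF oppr_eq0.
Qed.

Lemma root_Cyclotomic (F : fieldType) (n : nat) (z : F) :
  n.-primitive_root z -> (map_poly intr ('Phi_n) : {poly F}).[z] = 0.
Proof.
move=> prim_z; have n_gt0 := prim_order_gt0 prim_z.
have /(congr1 (fun p : {poly int} => (map_poly intr p : {poly F}).[z])) := prod_Cyclotomic n_gt0.
rewrite rmorphB rmorph1 /= map_polyXn hornerD hornerN hornerXn hornerC (prim_expr_order prim_z).
rewrite subrr rmorph_prod horner_prod => /eqP; rewrite prodf_seq_eq0 => /hasP[d].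
rewrite -dvdn_divisors //= => d_dv_n /eqP zd0.
have d_gt0 : (0 < d)%N by apply: dvdn_gt0 d_dv_n.
have /(congr1 (fun p : {poly int} => (map_poly intr p : {poly F}).[z])) := prod_Cyclotomic d_gt0.
rewrite (big_rem d) -?dvdn_divisors //= rmorphM hornerM zd0 mul0r => /esym/eqP.
rewrite rmorphB rmorph1 /= map_polyXn hornerD hornerN hornerXn hornerC subr_eq0.
rewrite -(prim_order_dvd prim_z) => n_dv_d.
by have -> : n = d by apply/eqP; rewrite eqn_dvd n_dv_d.
Qed.

(** Irreducibility is transported from [algC] through the gcd of ['Phi_n] and [h]. It is not
    constant, since a Bezout relation would fail at [z], so it has a root [y] in [algC]. This [y] is
    a primitive [n]-th root of unity with minimal polynomial ['Phi_n], and [h] vanishes at it. *)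
Lemma Cyclotomic_irr (F : fieldType) (n : nat) (z : F) (h : {poly int}) :
    [pchar F] =i pred0 -> n.-primitive_root z -> (map_poly intr h : {poly F}).[z] = 0 ->
  'Phi_n %| h.
Proof.
move=> charF prim_z hz0.
have Phiz0 := root_Cyclotomic prim_z.
have : ~~ coprimep 'Phi_n h.
  apply/negP => /Bezout_coprimepP[[u1 u2] /= /eqp_size]; rewrite size_poly1.
  move=> /eqP/size_poly1P[c c0 /(congr1 (fun p => (map_poly intr p : {poly F}).[z]))].
  rewrite rmorphD !rmorphM /= hornerD !hornerM Phiz0 hz0 !mulr0 addr0 map_polyC hornerC.
  by move/esym/eqP; rewrite intr_char0_eq0 // (negPf c0).
set g := gcdp 'Phi_n h => g1.
have [y gy0] : exists y : algC, root (map_poly intr g) y.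
  apply/closed_rootP; rewrite size_map_inj_poly ?rmorph0 //; exact: intr_inj.
have root_of q : g %| q -> root (map_poly intr q : {poly algC}) y.
  move=> /Pdiv.Idomain.dvdpP[[c r] /= c0 E].
  have /eqP : (map_poly intr (c *: q) : {poly algC}).[y] = 0.
    by rewrite E rmorphM hornerM (rootP gy0) mulr0.
  by rewrite map_polyZ hornerZ mulf_eq0 intr_eq0 (negPf c0).
have Phi_y := root_of _ (dvdp_gcdl 'Phi_n h); have h_y := root_of _ (dvdp_gcdr 'Phi_n h).
have n_gt0 := prim_order_gt0 prim_z.
have [x prim_x] := C_prim_root_exists n_gt0.
have prim_y : n.-primitive_root y.
  by rewrite -(root_cyclotomic prim_x) -(Cintr_Cyclotomic prim_x).
have [p [Ep _] Hp] := minCpolyP y.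
rewrite -dvdp_rat_int; have -> : map_poly intr 'Phi_n = p.
  apply: (map_inj_poly (fmorph_inj (@ratr algC))); first exact: rmorph0.
  rewrite -Ep (minCpoly_cyclotomic prim_y) -(Cintr_Cyclotomic prim_y) -map_poly_comp.
  by apply: eq_map_poly => c /=; rewrite ratr_int.
rewrite -Hp -map_poly_comp (eq_map_poly (g := intr)) // => c /=.
by rewrite ratr_int.
Qed.

(** This replaces Galois conjugation: a vanishing sum of powers of [z] is an integer polynomial
    vanishing at [z], hence, by divisibility by ['Phi_N], at the other primitive root [z ^+ k]. *)
Lemma unity_sum_conj (F : closedFieldType) (N n k : nat) (w : 'I_n -> F) :
    [pchar F] =i pred0 -> (0 < N)%N -> coprime k N -> (0 < k)%N ->
    (forall j, w j = 0 \/ w j ^+ N = 1) -> \sum_j w j = 0 ->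
  \sum_j w j ^+ k = 0.
Proof.
move=> charF N_gt0 coNk k_gt0 Hw sum0.
have [z prim_z] := closed_prim_root_exists charF N_gt0.
pose e j := if w j == 0 then 0%N else odflt 0%N (omap val [pick i : 'I_N | w j == z ^+ i]).
have we j : w j = if w j == 0 then 0 else z ^+ e j.
  rewrite /e; case: eqP => // wj0; case: (Hw j) => // /(prim_rootP prim_z)[i wi].
  by case: pickP => [i' /eqP //| /(_ i)]; rewrite wi eqxx.
pose h : {poly int} := \sum_(j | w j != 0) 'X^(e j).
have hE (y : F) : (map_poly intr h : {poly F}).[y] = \sum_(j | w j != 0) y ^+ e j.
  rewrite rmorph_sum horner_sum; apply: eq_bigr => j _.
  by rewrite /= map_polyXn hornerXn.
have hz : (map_poly intr h : {poly F}).[z] = 0.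
  rewrite hE -[RHS]sum0 big_mkcond /=; apply: eq_bigr => j _.
  by rewrite [RHS]we; case: eqP.
have /Pdiv.Idomain.dvdpP[[c q] /= c0 E] := Cyclotomic_irr charF prim_z hz.
have prim_zk : N.-primitive_root (z ^+ k) by rewrite prim_root_exp_coprime.
have /eqP : (map_poly intr (c *: h) : {poly F}).[z ^+ k] = 0.
  by rewrite E rmorphM hornerM (root_Cyclotomic prim_zk) mulr0.
rewrite map_polyZ hornerZ mulf_eq0 intr_char0_eq0 // (negPf c0) /= hE big_mkcond /= => /eqP sum_k.
rewrite -[RHS]sum_k; apply: eq_bigr => j _; rewrite {1}we.
by case: eqP => _ /=; rewrite ?expr0n ?gtn_eqF // -!exprM mulnC.
Qed.

(* All power sums of order at most [n] vanish, because [k <= n] is prime to [N]; a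
   polynomial isolating one of the nonzero values then contradicts its multiplicity. *)
Lemma unity_sum_eq0 (F : closedFieldType) (N n : nat) (w : 'I_n -> F) :
    [pchar F] =i pred0 -> (0 < N)%N -> (n < pdiv N)%N ->
    (forall j, w j = 0 \/ w j ^+ N = 1) -> \sum_j w j = 0 ->
  forall j, w j = 0.
Proof.
move=> charF N_gt0 nN Hw sum0 j0; apply/eqP/negPn/negP => wj0.
have pow k : (0 < k <= n)%N -> \sum_j w j ^+ k = 0.
  move=> /andP[k_gt0 le_kn]; apply: (unity_sum_conj charF N_gt0) => //.
  rewrite coprime_has_primes //; apply/hasPn => p; rewrite !mem_primes.
  move=> /and3P[p_pr _ p_dv_N]; apply/negP => /and3P[_ _ p_dv_k].
  have := pdiv_min_dvd (prime_gt1 p_pr) p_dv_N.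
  by have := dvdn_leq k_gt0 p_dv_k; lia.
(* The polynomial [g] vanishes at 0 and at every value of [w] other than [w j0]. It has degree at
   most [n] and no constant term, so summing it over the [w j] involves only the vanishing power
   sums. *)
pose v := rem (w j0) (undup [seq w j | j <- enum 'I_n & w j != 0]).
pose g := 'X * \prod_(a <- v) ('X - a%:P).
have sz_g : (size g <= n.+1)%N.
  rewrite /g mulrC size_mulX ?monic_neq0 ?monic_prod_XsubC // size_prod_XsubC ltnS.
  rewrite size_rem ?mem_undup; last first.
    by apply/mapP; exists j0 => //; rewrite mem_filter wj0 mem_enum.
  set l := map _ _; have : (size (undup l) <= n)%N.
    rewrite (leq_trans (size_undup _)) // size_map size_filter.
    by rewrite (leq_trans (count_size _ _)) // size_enum_ord.
  by have := ltn_ord j0; lia.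
have : \sum_j g.[w j] = 0.
  under eq_bigr do rewrite (horner_coef_wide _ sz_g).
  rewrite exchange_big /= big1 // => -[[|k] /= ltk] _.
    by rewrite coefXM /= big1 // => j _; rewrite mul0r.
  by rewrite -mulr_sumr pow ?mulr0.
have gw j : g.[w j] = if w j == w j0 then g.[w j0] else 0.
  case: eqP => [-> //|/eqP wj]; rewrite {1}/g hornerM hornerX.
  have [->|wn0] := eqVneq (w j) 0; first by rewrite mul0r.
  apply/eqP; rewrite mulf_eq0; apply/orP; right.
  rewrite -[_ == 0]/(root _ _) root_prod_XsubC mem_rem_uniq ?undup_uniq // inE /= wj.
  by rewrite mem_undup; apply/mapP; exists j => //; rewrite mem_filter wn0 mem_enum.
rewrite (eq_bigr _ (fun j _ => gw j)) -big_mkcond /= sumr_const -mulr_natr => /eqP.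
rewrite mulf_eq0 (pcharf0P F).1 //; apply/negP; rewrite negb_or; apply/andP; split.
  rewrite /g hornerM hornerX mulf_neq0 // -[_ == 0]/(root _ _) root_prod_XsubC.
  by rewrite mem_rem_uniqF ?undup_uniq.
by rewrite -lt0n; apply/card_gt0P; exists j0; apply: eqxx.
Qed.

(** * Regular pairs of power sums *)

Definition ideal2 (R : comNzRingType) (p q f : R) := exists u v, f = u * p + v * q.

Lemma ideal2D (R : comNzRingType) (p q f g : R) :
  ideal2 p q f -> ideal2 p q g -> ideal2 p q (f + g).
Proof.
by move=> [u [v ->]] [u' [v' ->]]; exists (u + u'), (v + v'); rewrite !mulrDl addrACA.
Qed.

Lemma ideal2M (R : comNzRingType) (p q f g : R) : ideal2 p q g -> ideal2 p q (f * g).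
Proof. by move=> [u [v ->]]; exists (f * u), (f * v); rewrite mulrDr !mulrA. Qed.

Lemma ideal2_0 (R : comNzRingType) (p q : R) : ideal2 p q 0.
Proof. by exists 0, 0; rewrite !mul0r addr0. Qed.

Lemma ideal2_in (R : comNzRingType) (p q u v : R) : ideal2 p q (u * p + v * q).
Proof. by exists u, v. Qed.

(* [p, q] is a regular sequence, in the symmetric form valid for nonzero elements of a domain. *)
Definition regular_pair (R : comNzRingType) (p q : R) :=
  forall h k, p * h = q * k -> exists m, h = q * m /\ k = p * m.

(** Since [rho k = u p k + v q k = p (u k + v h)], the polynomial [p] divides [rho] times the
    remainder of [k] modulo [p]. As [rho] is constant, degrees force this remainder to be 0. *)
Lemma regular_pair_resultant (A : idomainType) (p q u v : {poly A}) (rho : A) :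
    lead_coef p \is a GRing.unit -> rho != 0 -> rho%:P = u * p + v * q ->
  regular_pair p q.
Proof.
move=> up rho0 E h k phqk.
have pn0 : p != 0 by apply: contraTneq up => ->; rewrite lead_coef0 unitr0.
have Ek := Pdiv.IdomainUnit.divp_eq up k.
have r0 : k %% p = 0.
  have Er : (k %% p) * rho%:P = p * (u * k + v * h - rho%:P * (k %/ p)).
    have -> : k %% p = k - k %/ p * p by rewrite {2}Ek [X in X - _]addrC addrK.
    have -> : p * (u * k + v * h - rho%:P * (k %/ p))
            = u * p * k + v * (p * h) - rho%:P * (k %/ p) * p by ring.
    by rewrite phqk mulrBl {1}E; ring.
  apply/eqP/contraT => rn0; have := ltn_modp k p; rewrite pn0.
  have [z0|zn0] := eqVneq (u * k + v * h - rho%:P * (k %/ p)) 0.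
    move/eqP: Er; rewrite z0 mulr0 mulf_eq0 polyC_eq0 (negPf rho0) orbF.
    by rewrite (negPf rn0).
  have := congr1 (size : {poly A} -> nat) Er; rewrite mulrC size_Cmul // => ->.
  rewrite size_mul // -ltnS prednK; last by rewrite addn_gt0 size_poly_gt0 pn0.
  have := zn0; rewrite -size_poly_gt0; lia.
exists (k %/ p); rewrite r0 addr0 in Ek; split; last by rewrite mulrC.
by apply: (mulfI pn0); rewrite phqk {1}Ek; ring.
Qed.

(** At [c] the coefficients [al], [be] form a syzygy of [p.[c]] and [q.[c]], which regularity makes
    a multiple of the trivial one. After subtracting that multiple of the trivial syzygy of [p] and
    [q], both coefficients become divisible by [X - c]. *)
Lemma ideal2_horner_cancel (A : idomainType) (p q f : {poly A}) (c : A) :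
    regular_pair p.[c] q.[c] -> ideal2 p q (('X - c%:P) * f) -> ideal2 p q f.
Proof.
move=> reg [al [be E]].
have /reg[m [Ea Eb]] : p.[c] * al.[c] = q.[c] * - be.[c].
  have /eqP := congr1 (fun g => g.[c]) E.
  rewrite hornerM hornerXsubC subrr mul0r hornerD !hornerM eq_sym addr_eq0 => /eqP.
  by rewrite mulrC [q.[c] * _]mulrC mulNr.
have /factor_theorem[al' Eal] : root (al - q * m%:P) c.
  by rewrite /root hornerD hornerN hornerM hornerC -Ea subrr.
have /factor_theorem[be' Ebe] : root (be + p * m%:P) c.
  by rewrite /root hornerD hornerM hornerC -Eb subrr.
exists al', be'; apply: (@mulfI _ ('X - c%:P)); first by rewrite polyXsubC_eq0.
have -> : ('X - c%:P) * (al' * p + be' * q)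
    = al' * ('X - c%:P) * p + be' * ('X - c%:P) * q by ring.
by rewrite E -Eal -Ebe; ring.
Qed.

Lemma psumS (F : idomainType) n a :
  psum F n.+1 a = 'X^a + (psum F n a)%:P :> {poly mpoly F n}.
Proof.
rewrite /psum big_ord_recr /= eqxx addrC; congr (_ + _).
rewrite rmorph_sum; apply: eq_bigr => i _ /=.
by rewrite ltn_eqF // rmorphXn.
Qed.

(** Let [Y] be the outer variable. Modulo [Y^a + W] and [Y^b + V], the power [Y^(ab)] equals both
    [(- W)^b] and [(- V)^a], so their difference [rho] lies in the ideal and is free of [Y]. As
    [a + b] is odd, its two leading terms add up instead of cancelling. *)
Lemma power_resultant (A : idomainType) (a b : nat) (s t : A) :
    (0 < a)%N -> (0 < b)%N -> odd (a + b) -> 2%:R != 0 :> A ->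
  exists (rho : {poly A}) (u v : {poly {poly A}}),
    [/\ rho%:P = u * ('X^a + ('X^a + s%:P)%:P) + v * ('X^b + ('X^b + t%:P)%:P),
        rho != 0 & lead_coef rho = (-1) ^+ a * 2%:R].
Proof.
move=> a0 b0 oab two0.
pose W : {poly A} := 'X^a + s%:P; pose V : {poly A} := 'X^b + t%:P.
pose rho := (- V) ^+ a - (- W) ^+ b.
have mon m (c : A) : (0 < m)%N -> 'X^m + c%:P \is monic /\ size ('X^m + c%:P) = m.+1.
  move=> m0; have -> : 'X^m + c%:P = 'X^m - (- c)%:P by rewrite polyCN opprK.
  by rewrite monicXnsubC // size_XnsubC.
have [monW szW] := mon a s a0; have [monV szV] := mon b t b0.
have szVa : size (V ^+ a) = (a * b).+1.
  have := size_exp V a; rewrite szV /= mulnC => <-.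
  by rewrite prednK // size_poly_gt0 monic_neq0 ?monic_exp.
have szWb : size (W ^+ b) = (a * b).+1.
  have := size_exp W b; rewrite szW /= => <-.
  by rewrite prednK // size_poly_gt0 monic_neq0 ?monic_exp.
have Erho : rho = (-1) ^+ a *: (V ^+ a + W ^+ b).
  have sgn : (-1) ^+ b = - (-1) ^+ a :> {poly A}.
    rewrite -signr_odd -(signr_odd _ a); move: oab; rewrite oddD.
    by case: (odd a); case: (odd b) => //= _; rewrite ?expr0 ?expr1 ?opprK.
  rewrite -mul_polyC rmorphXn rmorphN1 /rho [(- V) ^+ a]exprNn [(- W) ^+ b]exprNn sgn.
  by rewrite mulrDr mulNr opprK.
have cab : (V ^+ a + W ^+ b)`_(a * b) = 2%:R.
  have lead (p : {poly A}) : p \is monic -> size p = (a * b).+1 -> p`_(a * b) = 1.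
    by move=> /monicP; rewrite lead_coefE => + E; rewrite E.
  by rewrite coefD !lead ?monic_exp.
have szsum : size (V ^+ a + W ^+ b) = (a * b).+1.
  apply/eqP; rewrite eqn_leq; apply/andP; split.
    by rewrite (leq_trans (size_polyD _ _)) // szVa szWb maxnn.
  by rewrite ltnNge; apply: contraNN two0 => le; rewrite -cab nth_default.
have lrho : lead_coef rho = (-1) ^+ a * 2%:R.
  by rewrite Erho lead_coefZ lead_coefE szsum cab.
have [u Eu] : exists u, ('X^a) ^+ b - (- W%:P) ^+ b = ('X^a + W%:P) * u :> {poly {poly A}}.
  by eexists; rewrite subrXX opprK.
have [v Ev] : exists v, ('X^b) ^+ a - (- V%:P) ^+ a = ('X^b + V%:P) * v :> {poly {poly A}}.
  by eexists; rewrite subrXX opprK.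
exists rho, u, (- v); split=> //.
  rewrite mulNr -/W -/V [u * _]mulrC [v * _]mulrC -Eu -Ev -!exprM [(b * a)%N]mulnC.
  by rewrite /rho rmorphB !rmorphXn !rmorphN /=; ring.
by rewrite -lead_coef_eq0 lrho mulf_neq0 // signr_eq0.
Qed.

Lemma psum_regular_pair (F : fieldType) n a b :
    [pchar F] =i pred0 -> (0 < a)%N -> (0 < b)%N -> odd (a + b) ->
  regular_pair (psum F n.+2 a) (psum F n.+2 b).
Proof.
move=> charF a0 b0 oab.
have two0 : 2%:R != 0 :> mpoly F n.
  by rewrite -(rmorph_nat (mconst F n)) fmorph_eq0 (pcharf0P F).1.
have [rho [u [v [E rho0 _]]]] := power_resultant (psum F n a) (psum F n b) a0 b0 oab two0.
move: E; rewrite -!psumS => E.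
rewrite (psumS F n.+1 a) (psumS F n.+1 b).
apply: (@regular_pair_resultant (mpoly F n.+1) _ _ u v rho _ rho0 E).
by rewrite -[_%:P]opprK -polyCN (monicP (monicXnsubC _ a0)) unitr1.
Qed.

Lemma pth_roots (F : closedFieldType) m (c : F) :
    [pchar F] =i pred0 -> (0 < m)%N -> c != 0 ->
  exists rs : seq F, [/\ size rs = m, uniq rs & forall y, y \in rs -> y ^+ m = c].
Proof.
move=> charF m0 c0; have [z prim_z] := closed_prim_root_exists charF m0.
have [y Ey] : exists y : F, root ('X^m - c%:P) y.
  by apply/closed_rootP; rewrite size_XnsubC //; lia.
move: Ey; rewrite /root hornerD hornerN hornerXn hornerC subr_eq0 => /eqP Ey.
exists [seq y * z ^+ i | i <- iota 0 m]; split.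
- by rewrite size_map size_iota.
- rewrite map_inj_in_uniq ?iota_uniq // => i j; rewrite !mem_iota /= !add0n => lti ltj.
  have y0 : y != 0 by apply: contraNneq c0 => y0; rewrite -Ey y0 expr0n gtn_eqF.
  move/(mulfI y0)/eqP; rewrite (eq_prim_root_expr prim_z) !modn_small //.
  by move/eqP.
- move=> _ /mapP[i _ ->]; rewrite exprMn Ey -exprM mulnC exprM (prim_expr_order prim_z).
  by rewrite expr1n mulr1.
Qed.

(** * Reducedness *)

Lemma grading_psum (F : idomainType) n (R : comNzRingType)
    (pi : {rmorphism mpoly F n -> R}) a :
  grading pi (psum F n a) = (pi (psum F n a))%:P * 'X^a.
Proof.
rewrite /psum !rmorph_sum mulr_suml; apply: eq_bigr => i _.
by rewrite [in LHS]rmorphXn [in RHS]rmorphXn /grading meval_var //= exprMn rmorphXn.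
Qed.

Lemma grading_linear (F : idomainType) n (R : comNzRingType)
    (pi : {rmorphism mpoly F n -> R}) c i : (i < n)%N ->
  grading pi (mconst F n c * mvar F n i) = (pi (mconst F n c * mvar F n i))%:P * 'X.
Proof. by move=> lt_in; rewrite !rmorphM /grading meval_const meval_var //= mulrA. Qed.

Lemma meval_psum (F : idomainType) (T : comNzRingType) (h : {rmorphism F -> T}) v n a :
  meval h v n (psum F n a) = \sum_(i < n) v i ^+ a.
Proof. by rewrite rmorph_sum; apply: eq_bigr => i _; rewrite rmorphXn meval_var. Qed.

Lemma psum_proper (F : idomainType) n a b : (0 < a)%N -> (0 < b)%N ->
  ~ ideal2 (psum F n a) (psum F n b) 1.
Proof.
move=> a0 b0 [u [v /(congr1 (meval (GRing.RMorphism.clone F F idfun _) (fun=> 0) n))]].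
rewrite rmorphD !rmorphM !meval_psum rmorph1 !big1 => [|i _|i _].
- by rewrite !mulr0 addr0 => /eqP; rewrite oner_eq0.
- by rewrite expr0n gtn_eqF.
- by rewrite expr0n gtn_eqF.
Qed.

Lemma psum_quotient (F : idomainType) n a b : (0 < a)%N -> (0 < b)%N ->
  exists (R : comNzRingType) (pi : {rmorphism mpoly F n -> R}) (r : R -> mpoly F n),
    [/\ forall f, pi f = 0 <-> ideal2 (psum F n a) (psum F n b) f, cancel r pi
      & forall f, pi f = 0 -> grading pi f = 0].
Proof.
move=> a0 b0.
have [R [pi [r [pi0 rK]]]] := quotient_exists (@ideal2D _ _ _) (@ideal2M _ _ _)
  (@ideal2_0 _ _ _) (@psum_proper F n a b a0 b0).
exists R, pi, r; split=> // f /pi0[u [v ->]].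
have pa : pi (psum F n a) = 0 by apply/pi0; exists 1, 0; rewrite mul1r mul0r addr0.
have pb : pi (psum F n b) = 0 by apply/pi0; exists 0, 1; rewrite mul1r mul0r add0r.
by rewrite rmorphD !rmorphM !grading_psum pa pb !mul0r !mulr0 addr0.
Qed.

Definition reduced_pair (R : comNzRingType) (p q : R) :=
  forall f, ideal2 p q (f * f) -> ideal2 p q f.

(** Let [t] be the linear form cutting out the hyperplane. If [h ^+ 2] is in the ideal, reducedness
    of the section gives [h = t h'] modulo the ideal, and cancelling [t] twice puts [h' ^+ 2] in the
    ideal. So [f] is divisible by every power of [t], and [graded_separated] concludes. *)
Lemma psum_reduced_hyperplane (F : fieldType) n a b (w : F) j :
    (0 < a)%N -> (0 < b)%N -> (j < n)%N ->
  let c := mconst F n w * mvar F n j in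
  let P := psum F n.+1 a : {poly mpoly F n} in
  let Q := psum F n.+1 b : {poly mpoly F n} in
  regular_pair P.[c] Q.[c] -> reduced_pair P.[c] Q.[c] -> reduced_pair P Q.
Proof.
move=> a0 b0 ltj c P Q reg red f ff.
have [R [pi [r [pi0 rK gr0]]]] := psum_quotient F n.+1 a0 b0.
pose t : {poly mpoly F n} := 'X - c%:P.
apply/pi0; refine (@graded_separated F n.+1 R pi t gr0 _ f _).
  have -> : t = mvar F n.+1 n - mconst F n.+1 w * mvar F n.+1 j :> mpoly F n.+1.
    by rewrite /t /c mvar_last mvarS // rmorphM.
  rewrite !rmorphB grading_linear 1?ltnW // mulrBl; congr (_ - _).
  by rewrite /grading meval_var.
move=> k; suff [h [Eh _]] : exists h, pi f = pi (t ^+ k * h) /\ ideal2 P Q (h * h) by exists h.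
elim: k => [|k [h [Eh hh]]]; first by exists f; rewrite mul1r.
have [u [v Ec]] : ideal2 P.[c] Q.[c] h.[c].
  apply: red; have [u [v E]] := hh; exists u.[c], v.[c].
  by rewrite -!hornerM -hornerD -E.
have /factor_theorem[h' Eh'] : root (h - (u%:P * P + v%:P * Q)) c.
  by rewrite /root hornerD hornerN hornerD !hornerM !hornerC Ec subrr.
have Ph : pi h = pi (t * h').
  apply/eqP; rewrite -subr_eq0 -rmorphB; apply/eqP/pi0; exists u%:P, v%:P.
  by rewrite [t * h']mulrC -Eh' opprB addrCA subrr addr0.
exists h'; split.
  by rewrite Eh exprSr -mulrA [LHS]rmorphM [RHS]rmorphM; congr (_ * _).
apply: (ideal2_horner_cancel reg); apply: (ideal2_horner_cancel reg).
rewrite !mulrA [_ * h']mulrC !mulrA -/t -[h' * t * t * h']mulrA.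
apply/pi0; rewrite [h' * t]mulrC.
by rewrite rmorphM -Ph -rmorphM; apply/pi0.
Qed.

(* Modulo [x1^a + x2^a], i.e. on each line [x2 = w x1] with [w^a = -1], the second
   generator is [tau x3^b + (1 + w^b) x1^b], which has [b] distinct linear factors. *)
Lemma reduced_base (F : closedFieldType) a b (tau : F) :
    [pchar F] =i pred0 -> (0 < a)%N -> (0 < b)%N -> tau != 0 ->
    (forall w : F, w ^+ a = -1 -> 1 + w ^+ b != 0) ->
  reduced_pair ((psum F 2 a)%:P : {poly mpoly F 2})
    ((mconst F 2 tau)%:P * 'X^b + (psum F 2 b)%:P).
Proof.
move=> charF a0 b0 tau0 Hw.
set p : {poly {poly F}} := psum F 2 a; set q : {poly {poly F}} := psum F 2 b.
set T : {poly {poly F}} := mconst F 2 tau.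
set Q : {poly {poly {poly F}}} := T%:P * 'X^b + q%:P.
change (reduced_pair (p%:P : {poly {poly {poly F}}}) Q).
have psum1 m : (0 < m)%N -> psum F 1 m = 'X^m :> {poly F}.
  by move=> m0; rewrite psumS /psum big_ord0 addr0.
have pE : p = 'X^a + ('X^a)%:P by rewrite /p psumS psum1.
have qE : q = 'X^b + ('X^b)%:P by rewrite /q psumS psum1.
have uT : T \is a GRing.unit by rewrite rmorph_unit // unitfE.
have T0 : T != 0 by rewrite fmorph_eq0.
have szT : size (T%:P * 'X^b) = b.+1 by rewrite size_mulXn ?polyC_eq0 // size_polyC T0 addn1.
have szq : (size q%:P < size (T%:P * 'X^b)%R)%N.
  by rewrite szT (leq_ltn_trans (size_polyC_leq1 _)).
have szQ : size Q = b.+1 by rewrite size_polyDl.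
have lQ : lead_coef Q \is a GRing.unit.
  by rewrite lead_coefDl // lead_coef_Mmonic ?monicXn // lead_coefC.
have monp : p \is monic by rewrite pE -[_%:P]opprK -polyCN monicXnsubC.
have szp : size p = a.+1 by rewrite pE -[_%:P]opprK -polyCN size_XnsubC.
have negone0 : -1 != 0 :> F by rewrite oppr_eq0 oner_eq0.
have [ws [sz_ws uniq_ws ws_a]] := pth_roots charF a0 negone0.
move=> f [u [v ff]].
have Ef := Pdiv.IdomainUnit.divp_eq lQ f.
set f0 := f %% Q in Ef; set k := f %/ Q in Ef.
have sz_f0 : (size f0 <= b)%N.
  by have := ltn_modp f Q; rewrite szQ ltnS -size_poly_gt0 szQ ltnS => ->.
have ff0 : f0 * f0 = u * p%:P + (v - k * k * Q - 2%:R * k * f0) * Q.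
  have -> : u * p%:P + (v - k * k * Q - 2%:R * k * f0) * Q
          = (u * p%:P + v * Q) - (k * Q + f0) * (k * Q + f0) + f0 * f0 by ring.
  by rewrite -ff -Ef subrr add0r.
(* On the line [x2 = w x1] the remainder has degree below [b] in [x3] but the [b] distinct roots
   [t x1] with [t ^+ b = - (1 + w ^+ b) / tau]. *)
have ev_f0 w : w \in ws -> map_poly (horner_eval (w *: 'X : {poly F})) f0 = 0.
  move=> ws_w; pose ev : {rmorphism {poly {poly F}} -> {poly F}} := horner_eval (w *: 'X : {poly F}).
  have w_a := ws_a _ ws_w.
  have wb0 : - (tau^-1 * (1 + w ^+ b)) != 0.
    by rewrite oppr_eq0 mulf_neq0 ?invr_eq0 // Hw.
  have [th [sz_th uniq_th th_b]] := pth_roots charF b0 wb0.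
  have ev_p : ev p = 0.
    rewrite /ev /= /horner_eval pE hornerD hornerXn hornerC exprZn w_a scaleN1r addrC subrr //.
  have ev_q : ev q = (1 + w ^+ b) *: 'X^b.
    by rewrite /ev /= /horner_eval qE hornerD hornerXn hornerC exprZn addrC scalerDl scale1r.
  have ev_T : ev T = tau%:P by rewrite /ev /= /horner_eval /T /= hornerC.
  change (map_poly ev f0 = 0); apply/eqP/contraT => fn0.
  have := max_poly_roots fn0 (rs := [seq t *: 'X | t <- th]).
  rewrite size_map sz_th map_inj_uniq ?uniq_th; last first.
    move=> t t' /(congr1 (fun g : {poly F} => g`_1)).
    by rewrite !coefZ coefX !mulr1.
  have allr : all (root (map_poly ev f0)) [seq t *: 'X | t <- th].
    apply/allP => _ /mapP[t th_t ->].
    have Q0 : (map_poly ev Q).[t *: 'X] = 0.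
      rewrite rmorphD rmorphM /= !map_polyC map_polyXn /= -/ev ev_T ev_q.
      rewrite hornerD hornerM hornerXn !hornerC exprZn (th_b _ th_t) mul_polyC scalerA mulrN mulVKf //.
      by rewrite scaleNr addrC subrr.
    have P0 : (map_poly ev p%:P).[t *: 'X] = 0 by rewrite map_polyC hornerC; apply: ev_p.
    have : (map_poly ev f0).[t *: 'X] * (map_poly ev f0).[t *: 'X] = 0.
      have evM g h : map_poly ev (g * h) = map_poly ev g * map_poly ev h by exact: rmorphM.
      have evD g h : map_poly ev (g + h) = map_poly ev g + map_poly ev h by exact: rmorphD.
      by rewrite -hornerM -evM ff0 evD !evM hornerD !hornerM Q0 P0 !mulr0 addr0.
    by move/eqP; rewrite mulf_eq0 orbb.
  move=> /(_ allr isT); rewrite ltnNge.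
  by rewrite (leq_trans (size_poly _ _)).
(* Modulo [p], each coefficient has degree below [a] in [x2] but the [a] distinct roots [w x1]. *)
have div_f0 i : f0`_i %% p = 0.
  have up : lead_coef p \is a GRing.unit by rewrite (monicP monp) unitr1.
  have Ei := Pdiv.IdomainUnit.divp_eq up f0`_i.
  apply/eqP/contraT => rn0.
  have := max_poly_roots rn0 (rs := [seq w *: 'X | w <- ws]).
  rewrite size_map sz_ws map_inj_uniq ?uniq_ws; last first.
    move=> t t' /(congr1 (fun g : {poly F} => g`_1)).
    by rewrite !coefZ coefX !mulr1.
  have allr : all (root (f0`_i %% p)) [seq w *: 'X | w <- ws].
    apply/allP => _ /mapP[w ws_w ->]; apply/eqP.
    have := congr1 (fun g : {poly {poly F}} => g`_i) (ev_f0 w ws_w).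
    rewrite coef_map coef0 /= /horner_eval {1}Ei hornerD hornerM.
    by rewrite {2}pE hornerD hornerXn hornerC exprZn (ws_a _ ws_w) scaleN1r addNr mulr0 add0r.
  move=> /(_ allr isT); have := ltn_modp f0`_i p; rewrite szp monic_neq0 //.
  by rewrite ltnS ltnNge => ->.
exists (map_poly (fun c => c %/ p) f0), k; rewrite addrC {1}Ef; congr (_ + _).
apply/polyP => i; rewrite coefMC coef_map_id0 ?div0p //.
have up : lead_coef p \is a GRing.unit by rewrite (monicP monp) unitr1.
by rewrite {1}(Pdiv.IdomainUnit.divp_eq up f0`_i) div_f0 addr0.
Qed.

Lemma regular_pairC (R : comNzRingType) (p q : R) : regular_pair p q -> regular_pair q p.
Proof. by move=> reg h k /esym/reg[m [-> ->]]; exists m. Qed.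

Lemma regular_pair_const (A : idomainType) (p : {poly A}) (c : A) :
  lead_coef p \is a GRing.unit -> c != 0 -> regular_pair p c%:P.
Proof.
by move=> up c0; apply: (regular_pair_resultant (u := 0) (v := 1) up c0); rewrite mul0r mul1r add0r.
Qed.

Lemma psum_horner (F : idomainType) n a (c : mpoly F n) :
  (psum F n.+1 a : {poly mpoly F n}).[c] = c ^+ a + psum F n a.
Proof. by rewrite psumS hornerD hornerXn hornerC. Qed.

Lemma psum_horner0 (F : idomainType) n a : (0 < a)%N ->
  (psum F n.+1 a : {poly mpoly F n}).[0] = psum F n a.
Proof. by move=> a0; rewrite psum_horner expr0n gtn_eqF ?add0r. Qed.

(** Were also [w ^+ b = -1], then [w ^+ (b - a) = 1]; raising to the power [a] would give
    [(-1) ^+ (b - a) = 1] with [b - a] odd. *)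
Lemma add1_root_neg1 (F : fieldType) a b (w : F) : [pchar F] =i pred0 ->
  (a < b)%N -> odd (b - a) -> w ^+ a = -1 -> 1 + w ^+ b != 0.
Proof.
move=> charF lt_ab oba wa; have -> : b = (a + (b - a))%N by lia.
rewrite exprD wa mulN1r subr_eq0; apply/eqP => wN.
have : (-1) ^+ (b - a) = 1 :> F by rewrite -wa exprAC -wN expr1n.
rewrite -signr_odd oba expr1 => /eqP; rewrite -subr_eq0 -opprD oppr_eq0.
by rewrite -[_ + _]/(2%:R) (pcharf0P F).1.
Qed.

Lemma psum_reduced (F : closedFieldType) n a b :
    [pchar F] =i pred0 -> (4 <= n)%N -> (0 < a)%N -> (a < b)%N -> odd (b - a) ->
  reduced_pair (psum F n a) (psum F n b).
Proof.
move=> charF le4n a0 lt_ab oba.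
have b0 : (0 < b)%N by lia.
have oab : odd (a + b) by lia.
elim: n le4n => // n IHn; rewrite ltnS leq_eqVlt => /predU1P[<-|lt3n]; last first.
  have n0 : (0 < n)%N by lia.
  (* Slope 0 makes the last variable vanish on the section, whatever the other variable is. *)
  have c0 : mconst F n 0 * mvar F n 0 = 0 by rewrite rmorph0 mul0r.
  apply: (@psum_reduced_hyperplane F n a b 0 0%N) => //; rewrite c0 !psum_horner0 //.
    by case: n lt3n {IHn n0 c0} => [|[|n]] // _; apply: psum_regular_pair.
  exact: IHn.
(* For four variables, [x4 = w x3] cancels [x3^a + x4^a] and turns [x3^b + x4^b] into
   [(1 + w^b) x3^b]. *)
have [w wa] : exists w : F, w ^+ a = -1.
  have [|[|w ws] [sz _ Hw]] := @pth_roots F a (-1) charF a0.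
  - by rewrite oppr_eq0 oner_eq0.
  - by move: a0; rewrite -sz.
  - by exists w; apply: Hw; rewrite inE eqxx.
have tau0 := add1_root_neg1 charF lt_ab oba wa.
set tau := 1 + w ^+ b in tau0.
pose T : {poly mpoly F 2} := (mconst F 2 tau)%:P * 'X^b + (psum F 2 b)%:P.
have cE : mconst F 3 w * mvar F 3 2 = (mconst F 2 w)%:P * 'X :> {poly mpoly F 2}.
  by rewrite mvar_last.
have Ea : (psum F 4 a : {poly mpoly F 3}).[mconst F 3 w * mvar F 3 2]
    = (psum F 2 a)%:P :> {poly mpoly F 2}.
  rewrite psum_horner cE psumS exprMn -rmorphXn -rmorphXn wa !rmorphN1 mulN1r.
  by rewrite addKr.
have Eb : (psum F 4 b : {poly mpoly F 3}).[mconst F 3 w * mvar F 3 2] = T.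
  have Etau : (mconst F 2 tau)%:P = 1 + (mconst F 2 (w ^+ b))%:P :> {poly mpoly F 2}.
    by rewrite rmorphD rmorph1 polyCD polyC1.
  rewrite psum_horner cE psumS exprMn -rmorphXn -rmorphXn addrA /T Etau.
  have aux (A : comNzRingType) (x y z : A) : x * y + y + z = (1 + x) * y + z by ring.
  exact: aux.
apply: (@psum_reduced_hyperplane F 3 a b w 2) => //; rewrite Ea Eb; last first.
  apply: reduced_base => // v; exact: add1_root_neg1.
have T0 : mconst F 2 tau != 0 by rewrite fmorph_eq0.
apply: regular_pairC; apply: (@regular_pair_const (mpoly F 2)).
- have lt : (size ((psum F 2 b)%:P : {poly mpoly F 2})
      < size ((mconst F 2 tau)%:P * 'X^b : {poly mpoly F 2})%R)%N.
    rewrite (leq_ltn_trans (size_polyC_leq1 _)) //.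
    by rewrite size_mulXn ?polyC_eq0 // size_polyC T0 addn1.
  by rewrite lead_coefDl // lead_coef_Mmonic ?monicXn // lead_coefC rmorph_unit // unitfE.
- rewrite psumS -size_poly_gt0 -[_%:P]opprK -polyCN.
  by rewrite size_XnsubC.
Qed.

(** * Jacobian derivations and integrality *)

Lemma derivation0 (R : comNzRingType) (D : R -> R) : derivation D -> D 0 = 0.
Proof. by move=> [DD _]; apply: (addrI (D 0)); rewrite -DD !addr0. Qed.

Lemma derivation_quotient (S R : comNzRingType) (pi : {rmorphism S -> R}) (r : R -> S)
    (D : S -> S) :
    cancel r pi -> derivation D -> (forall f, pi f = 0 -> pi (D f) = 0) ->
  exists D' : R -> R, derivation D' /\ forall f, D' (pi f) = pi (D f).
Proof.
move=> rK [DD DM] D0.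
have DN u : D (- u) = - D u.
  by apply/eqP; rewrite -addr_eq0 -DD addNr derivation0.
have Dpi f g : pi f = pi g -> pi (D f) = pi (D g).
  move=> E; apply/eqP; rewrite -subr_eq0 -rmorphB -DN -DD.
  by rewrite D0 // rmorphB E subrr.
exists (fun x => pi (D (r x))); split; last by move=> f; apply: Dpi; rewrite rK.
split=> x y.
  by rewrite -rmorphD -DD; apply: Dpi; rewrite rmorphD !rK.
transitivity (pi (D (r x * r y))); first by apply: Dpi; rewrite rmorphM !rK.
by rewrite DM rmorphD !rmorphM !rK.
Qed.

Lemma mderiv_pow (F : idomainType) n i k (u : mpoly F n) :
  mderiv F n i (u ^+ k) = k%:R * u ^+ k.-1 * mderiv F n i u.
Proof.
case: k => [|k]; first by rewrite expr0 -(rmorph1 (mconst F n)) mderiv_const !mul0r.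
elim: k => [|k IHk]; first by rewrite expr1 expr0 !mul1r.
by rewrite exprS mderivM IHk /= -[in RHS]natr1 exprS; ring.
Qed.

Lemma mderiv_psum (F : idomainType) n i a : (i < n)%N ->
  mderiv F n i (psum F n a) = a%:R * mvar F n i ^+ a.-1.
Proof.
move=> lt_in; rewrite /psum raddf_sum (bigD1 (Ordinal lt_in)) //= big1 ?addr0.
  by rewrite mderiv_pow mderiv_var // eqxx mulr1.
move=> j neq_ji; rewrite mderiv_pow mderiv_var //.
by rewrite -val_eqE /= eq_sym in neq_ji; rewrite (negPf neq_ji) mulr0.
Qed.

(** The 2x2 Jacobian minor of the two power sums in the variables [i] and [j], up to the factor
    [a b]. *)
Definition minor (F : idomainType) n a b i j : mpoly F n :=
  mvar F n i ^+ a.-1 * mvar F n j ^+ b.-1 - mvar F n j ^+ a.-1 * mvar F n i ^+ b.-1.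

(* The 3x3 determinant whose rows are, up to the factors [a] and [b], the gradients of
   [psum a], [psum b] and [h], restricted to the variables [i], [j], [k]. *)
Definition jacobian_derivation (F : idomainType) n a b i j k (h : mpoly F n) : mpoly F n :=
  minor F n a b j k * mderiv F n i h - minor F n a b i k * mderiv F n j h
  + minor F n a b i j * mderiv F n k h.

Lemma jacobian_derivationP (F : idomainType) n a b i j k :
  derivation (@jacobian_derivation F n a b i j k).
Proof.
by split=> u v; rewrite /jacobian_derivation ?raddfD ?mderivM; ring.
Qed.

Lemma jacobian_derivation_psum (F : idomainType) n a b i j k :
    (i < n)%N -> (j < n)%N -> (k < n)%N ->
  jacobian_derivation a b i j k (psum F n a) = 0 /\
  jacobian_derivation a b i j k (psum F n b) = 0.
Proof.
by move=> *; split; rewrite /jacobian_derivation /minor !mderiv_psum //; ring.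
Qed.

Definition psum_kernel (F : idomainType) n a b (R : comNzRingType)
    (pi : {rmorphism mpoly F n -> R}) :=
  forall f, pi f = 0 <-> ideal2 (psum F n a) (psum F n b) f.

Lemma jacobian_derivation_quotient (F : idomainType) n a b i j k (R : comNzRingType)
    (pi : {rmorphism mpoly F n -> R}) (r : R -> mpoly F n) :
    psum_kernel a b pi -> cancel r pi -> (i < n)%N -> (j < n)%N -> (k < n)%N ->
  exists D : R -> R, derivation D /\
    forall f, D (pi f) = pi (jacobian_derivation a b i j k f).
Proof.
move=> pi0 rK lti ltj ltk.
refine (@derivation_quotient (mpoly F n) R pi r _ rK (@jacobian_derivationP F n a b i j k) _) => f /pi0[u [v ->]].
have [DD DM] := @jacobian_derivationP F n a b i j k.
have [Da Db] := @jacobian_derivation_psum F n a b i j k lti ltj ltk.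
by apply/pi0; rewrite DD !DM Da Db !mulr0 !addr0; apply: ideal2_in.
Qed.

(** The variable of index [m] is a root of the resultant [rho], monic after scaling by the inverse
    of its leading coefficient; the one of index [m.+1] then satisfies [Y^a + s = 0] with [s]
    integral. *)
Lemma psum_integral (F : fieldType) m a b (R : comNzRingType)
    (pi : {rmorphism mpoly F m.+2 -> R}) :
    [pchar F] =i pred0 -> (0 < a)%N -> (0 < b)%N -> odd (a + b) ->
    psum_kernel a b pi ->
  forall f, integralOver (fun d : mpoly F m => pi (d%:P%:P : {poly {poly mpoly F m}})) (pi f).
Proof.
move=> charF a0 b0 oab pi0.
pose cc : {rmorphism mpoly F m -> {poly {poly mpoly F m}}} := polyC \o polyC.
pose iota : {rmorphism mpoly F m -> R} := pi \o cc.
change (forall f, integralOver iota (pi f)).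
have two0 : 2%:R != 0 :> mpoly F m.
  by rewrite -(rmorph_nat (mconst F m)) fmorph_eq0 (pcharf0P F).1.
have int_z : integralOver iota (pi (mvar F m.+2 m)).
  have [rho [u [v [E rho0 lc]]]] := power_resultant (psum F m a) (psum F m b) a0 b0 oab two0.
  pose k : mpoly F m := mconst F m (((-1) ^+ a * 2%:R)^-1).
  have Ek : k * lead_coef rho = 1.
    rewrite lc -(rmorph_nat (mconst F m)) -(rmorphN1 (mconst F m)) -rmorphXn -!rmorphM.
    rewrite mulVf ?rmorph1 // mulf_neq0 ?signr_eq0 //.
    by rewrite (pcharf0P F).1.
  exists (k *: rho); first by rewrite monicE lead_coefZ Ek.
  have -> : mvar F m.+2 m = 'X%:P :> {poly {poly mpoly F m}} by rewrite mvarS // mvar_last.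
  have Epi (g : {poly mpoly F m}) :
      (map_poly iota g).[pi ('X%:P : {poly {poly mpoly F m}})] = pi (g%:P : {poly {poly mpoly F m}}).
    elim/poly_ind: g => [|g d IH]; first by rewrite !rmorph0 horner0.
    rewrite rmorphD rmorphM /= map_polyX map_polyC hornerMXaddC IH polyCD polyCM.
    by rewrite rmorphD rmorphM.
  rewrite /root Epi; apply/eqP/pi0.
  have -> : ((k *: rho)%:P : {poly {poly mpoly F m}}) = k%:P%:P * rho%:P.
    by rewrite -polyCM mul_polyC.
  apply: ideal2M; exists u, v.
  by rewrite E (psumS F m.+1 a) (psumS F m.+1 b) (psumS F m a) (psumS F m b).
have int_exp x k : integralOver iota x -> integralOver iota (x ^+ k).
  move=> int_x; elim: k => [|k IHk]; first exact: integral1.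
  by rewrite exprS; apply: integral_mul.
have int_y : integralOver iota (pi (mvar F m.+2 m.+1)).
  pose s : R := pi ((psum F m.+1 a)%:P : {poly mpoly F m.+1}).
  have int_s : integralOver iota s.
    have -> : s = pi (mvar F m.+2 m) ^+ a + iota (psum F m a).
      rewrite /s psumS polyCD rmorphD mvarS // mvar_last; congr (_ + _).
      by rewrite polyC_exp rmorphXn.
    apply: integral_add; first exact: (int_exp _ _ int_z).
    exact: (integral_id iota (psum F m a)).
  apply: (@integral_root_monic _ _ _ _ ('X^a + s%:P)).
  - by rewrite -[_%:P]opprK -polyCN monicXnsubC.
  - rewrite /root hornerD hornerXn hornerC.
    have -> : pi (mvar F m.+2 m.+1) ^+ a + s = pi (psum F m.+2 a).
      by rewrite (psumS F m.+1 a) rmorphD rmorphXn mvar_last.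
    by apply/eqP/pi0; exists 1, 0; rewrite mul1r mul0r addr0.
  apply/integral_poly => i; rewrite coefD coefXn coefC.
  by apply: integral_add; [exact: integral_nat | case: ifP => _ //; exact: integral0].
apply: mpoly_ind => [c|i lti|u v Iu Iv|u v Iu Iv].
- exact: (integral_id iota (mconst F m c)).
- move: lti; rewrite ltnS leq_eqVlt => /predU1P[-> //|].
  rewrite ltnS leq_eqVlt => /predU1P[-> //|lti].
  rewrite mvarS ?mvarS //; last by lia.
  exact: (integral_id iota (mvar F m i)).
- by rewrite rmorphD; apply: integral_add.
- by rewrite rmorphM; apply: integral_mul.
Qed.

(** Write the monic polynomial annihilating [f] as [q X^k] with [q(0)] nonzero. Reducedness turns
    [q(f) f^k = 0] into [q(f) f = 0], so [q(f)] is in [Ann(f)], while [q(0) - q(f)] is a multiple of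
    [f] and thus in [Ann(Ann(f))]. Take [d = q(0)]. *)
Lemma ann_sum_integral (A : idomainType) (R : comNzRingType) (iota : {rmorphism A -> R}) (f : R) :
    (forall x : R, x * x = 0 -> x = 0) -> integralOver iota f ->
  exists d, d != 0 /\ ann_sum f (iota d).
Proof.
move=> red [chi mon_chi chi0].
have nil k (x : R) : x ^+ k = 0 -> x = 0.
  elim/ltn_ind: k => k IHk xk; case: k IHk xk => [|[|k]] IHk xk.
  - by have /eqP := xk; rewrite expr0 oner_eq0.
  - by rewrite -[x]expr1.
  apply: (IHk k.+1) => //; apply: red; rewrite -exprD.
  have -> : (k.+1 + k.+1 = k.+2 + k)%N by lia.
  by rewrite exprD xk mul0r.
have [k [q]] := multiplicity_XsubC chi 0; rewrite (monic_neq0 mon_chi) polyC0 subr0 /= => q0 Echi.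
exists q.[0]; split; first exact: q0.
have uf : (map_poly iota q).[f] * f = 0.
  move: chi0; rewrite Echi rmorphM /= rmorphXn /= map_polyX /root hornerM hornerXn => /eqP E.
  apply: (nil k.+1); rewrite exprMn; set u := _.[f] in E *.
  have -> : u ^+ k.+1 * f ^+ k.+1 = u ^+ k * f * (u * f ^+ k) by rewrite !exprS; ring.
  by rewrite E mulr0.
have /factor_theorem[w Ew] : root (q - q.[0]%:P) 0.
  by rewrite /root hornerD hornerN hornerC subrr.
exists (- ((map_poly iota w).[f] * f)), (map_poly iota q).[f]; split=> //.
  by move=> g gf; rewrite mulNr -mulrA [f * g]mulrC gf mulr0 oppr0.
have Eq : q = w * 'X + q.[0]%:P by rewrite -['X]subr0 -polyC0 -Ew subrK.
by rewrite {2}Eq rmorphD rmorphM /= map_polyX map_polyC hornerMXaddC addKr.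
Qed.

(** The Jacobian derivation in the variables [m], [m.+1] and [k] acts on polynomials in the first
    [m] variables as the minor times the partial derivative in [k], so [derivation_elim] applies. *)
Lemma ann_sum_last_minor (F : fieldType) m a b (R : comNzRingType)
    (pi : {rmorphism mpoly F m.+2 -> R}) (r : R -> mpoly F m.+2) :
    [pchar F] =i pred0 -> (0 < a)%N -> (0 < b)%N -> odd (a + b) ->
    psum_kernel a b pi -> cancel r pi -> (forall x : R, x * x = 0 -> x = 0) ->
  forall f, exists N, ann_sum f (pi (minor F m.+2 a b m m.+1) ^+ N).
Proof.
move=> charF a0 b0 oab pi0 rK red f.
pose cc : {rmorphism mpoly F m -> {poly {poly mpoly F m}}} := polyC \o polyC.
pose iota : {rmorphism mpoly F m -> R} := pi \o cc.
have int_f : integralOver iota f.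
  by rewrite -(rK f); apply: (psum_integral charF a0 b0 oab pi0).
have [d [d0 Jd]] := ann_sum_integral red int_f.
apply: (@derivation_elim F m R (ann_sum f) _ iota charF _ _ _ d 0%N d0); last by rewrite mulr1.
- exact: ann_sumD.
- exact: ann_sumM.
move=> k ltk.
have [||| D [derD DE]] := @jacobian_derivation_quotient F m.+2 a b m m.+1 k R pi r pi0 rK.
- by lia.
- by [].
- by lia.
exists D; split=> //; first by move=> h; apply: ann_sum_derivation.
move=> c; pose c2 : {poly mpoly F m.+1} := ((c%:P : {poly mpoly F m}) : mpoly F m.+1)%:P.
have E1 : mderiv F m.+2 m.+1 c2 = 0 by rewrite mderiv_last derivC.
have E2 : mderiv F m.+2 m c2 = 0.
  rewrite mderivS // map_polyC; apply/eqP; rewrite polyC_eq0; apply/eqP.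
  by rewrite [LHS](mderiv_last (c%:P : {poly mpoly F m})) derivC.
have E3 : mderiv F m.+2 k c2 = cc (mderiv F m k c).
  rewrite mderivS 1?ltnW // map_polyC; congr (_%:P).
  by rewrite [LHS](mderivS (c%:P : {poly mpoly F m})) // map_polyC.
rewrite -[iota c]/(pi c2) DE /jacobian_derivation E1 E2 E3 !mulr0 subrr add0r.
exact: rmorphM.
Qed.

(** * The singular locus *)

Definition perm_vars (F : idomainType) n (s : 'S_n) : {rmorphism mpoly F n -> mpoly F n} :=
  meval (mconst F n) (fun k => oapp (fun i : 'I_n => mvar F n (s i)) 0 (insub k)) n.

Lemma perm_vars_var (F : idomainType) n (s : 'S_n) (i : 'I_n) :
  perm_vars F s (mvar F n i) = mvar F n (s i).
Proof. by rewrite /perm_vars meval_var // valK. Qed.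

Lemma perm_vars_psum (F : idomainType) n (s : 'S_n) a :
  perm_vars F s (psum F n a) = psum F n a.
Proof.
rewrite rmorph_sum [RHS](reindex_inj (@perm_inj _ s)) /=.
by apply: eq_bigr => i _; rewrite rmorphXn perm_vars_var.
Qed.

Lemma perm_varsK (F : idomainType) n (s : 'S_n) :
  cancel (perm_vars F s) (perm_vars F s^-1%g).
Proof.
pose id' : {rmorphism mpoly F n -> mpoly F n} := GRing.RMorphism.clone _ _ idfun _.
apply: (mpoly_ext (g := perm_vars F s^-1%g \o perm_vars F s) (h := id')) => [c|i lti] /=.
  by rewrite /perm_vars !meval_const.
by rewrite (perm_vars_var F s (Ordinal lti)) perm_vars_var permK.
Qed.

Lemma perm_vars_ideal2 (F : idomainType) n (s : 'S_n) a b f :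
  ideal2 (psum F n a) (psum F n b) f ->
  ideal2 (psum F n a) (psum F n b) (perm_vars F s f).
Proof.
move=> [u [v ->]]; exists (perm_vars F s u), (perm_vars F s v).
by rewrite rmorphD !rmorphM !perm_vars_psum.
Qed.

(** Power sums are symmetric, so composing [pi] with a permutation of the variables keeps its kernel
    and reduces to the last two variables. *)
Lemma ann_sum_minor (F : fieldType) n a b i j (R : comNzRingType)
    (pi : {rmorphism mpoly F n -> R}) (r : R -> mpoly F n) :
    [pchar F] =i pred0 -> (0 < a)%N -> (0 < b)%N -> odd (a + b) ->
    (i < n)%N -> (j < n)%N -> i != j ->
    psum_kernel a b pi -> cancel r pi -> (forall x : R, x * x = 0 -> x = 0) ->
  forall f, exists N, ann_sum f (pi (minor F n a b i j) ^+ N).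
Proof.
move=> charF a0 b0 oab lti ltj neq_ij pi0 rK red f.
case: n pi r pi0 rK lti ltj => [|[|m]] pi r pi0 rK lti ltj; [by []|by lia|].
pose i0 : 'I_m.+2 := Ordinal (ltnW (leqnn m.+2)); pose j0 : 'I_m.+2 := Ordinal (leqnn m.+2).
pose i1 : 'I_m.+2 := Ordinal lti; pose j1 : 'I_m.+2 := Ordinal ltj.
have [s [si sj]] : exists s : 'S_m.+2, s i0 = i1 /\ s j0 = j1.
  (* The first factor moves [j0] to the preimage of [j1] under the second; it fixes [i0] because
     [i0], [j0] differ and so do [i1], [j1]. *)
  exists (tperm j0 (tperm i0 i1 j1) * tperm i0 i1)%g; rewrite !permM tpermL tpermK.
  split=> //; rewrite [tperm _ _ i0]tpermD ?tpermL //.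
    by rewrite -val_eqE /= gtn_eqF.
  apply/eqP => /(congr1 (tperm i0 i1)); rewrite tpermK tpermL => /eqP.
  by rewrite -val_eqE /= eq_sym (negPf neq_ij).
pose pi' : {rmorphism mpoly F m.+2 -> R} := pi \o perm_vars F s.
have pi'0 : psum_kernel a b pi'.
  move=> g; rewrite /pi' /=; split=> [/pi0|/(perm_vars_ideal2 s) gI]; last exact/pi0.
  by move=> /(perm_vars_ideal2 s^-1%g); rewrite perm_varsK.
have r'K : cancel (perm_vars F s^-1%g \o r) pi'.
  move=> x; rewrite -[RHS]rK; congr (pi _).
  by have := perm_varsK s^-1%g (r x); rewrite invgK.
have [N JN] := ann_sum_last_minor charF a0 b0 oab pi'0 r'K red f.
have Ei : perm_vars F s (mvar F m.+2 m) = mvar F m.+2 i by rewrite (perm_vars_var F s i0) si.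
have Ej : perm_vars F s (mvar F m.+2 m.+1) = mvar F m.+2 j by rewrite (perm_vars_var F s j0) sj.
exists N; suff <- : perm_vars F s (minor F m.+2 a b m m.+1) = minor F m.+2 a b i j by [].
rewrite /minor; move: Ei Ej; set x := mvar _ _ _; set y := mvar _ _ _ => Ei Ej.
by rewrite rmorphB !rmorphM !rmorphXn Ei Ej.
Qed.

Definition radical_ideal (R : comNzRingType) (K : R -> Prop) :=
  [/\ forall u v, K u -> K v -> K (u + v), forall u v, K v -> K (u * v)
    & forall u, K (u * u) -> K u].

Lemma radical_idealX (R : comNzRingType) (K : R -> Prop) u k :
  radical_ideal K -> K (u ^+ k) -> K u.
Proof.
move=> [_ KM Kr]; elim/ltn_ind: k => k IHk; case: k IHk => [|[|k]] IHk Ku.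
- by rewrite -[u]mulr1; apply: KM.
- by rewrite -[u]expr1.
apply: (IHk k.+1) => //; apply: Kr; rewrite -exprD.
have -> : (k.+1 + k.+1 = k + k.+2)%N by lia.
by rewrite exprD; apply: KM.
Qed.

Lemma radical_of_ideal (R : comNzRingType) (J : R -> Prop) :
    (forall u v, J u -> J v -> J (u + v)) -> (forall u v, J v -> J (u * v)) -> J 0 ->
  radical_ideal (fun h => exists N, J (h ^+ N)).
Proof.
move=> JD JM J0; split=> [u v [N Ju] [M Jv]|u v [N Jv]|u [N Ju]].
- exists (N + M)%N; rewrite exprDn.
  apply: (big_ind J) => // i _; rewrite -mulr_natl; apply: (JM).
  have [le_iN|lt_Ni] := leqP (i : nat) M.
    have -> : (N + M - i = (M - i) + N)%N by lia.
    by rewrite exprD mulrAC; apply: JM.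
  have -> : (i = (i - M) + M :> nat)%N by lia.
  by rewrite [v ^+ _]exprD mulrA; apply: JM.
- by exists N; rewrite exprMn; apply: JM.
- by exists (N + N)%N; rewrite exprD -exprMn.
Qed.

Lemma radical_colon (R : comNzRingType) (K : R -> Prop) y :
  radical_ideal K -> radical_ideal (fun h => K (h * y)).
Proof.
move=> [KD KM Kr]; split=> [u v Ku Kv|u v Kv|u Ku].
- by rewrite mulrDl; apply: KD.
- by rewrite -mulrA; apply: KM.
- by apply: Kr; rewrite mulrACA mulrA; rewrite mulrC; apply: KM.
Qed.

(* If a product lies in [K], one may argue as if one of its factors did: a radical ideal
   is recovered from its colon ideals. *)
Lemma radical_prod_cases (R : comNzRingType) (x : R) (L : seq R) (K : R -> Prop) :
    radical_ideal K -> K (\prod_(y <- L) y) ->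
    (forall (K' : R -> Prop) y, radical_ideal K' -> (forall h, K h -> K' h) ->
       y \in L -> K' y -> K' x) ->
  K x.
Proof.
elim: L K => [|y L IHL] K radK.
  by rewrite big_nil => K1 _; rewrite -[x]mulr1; case: radK => _ KM _; apply: KM.
rewrite big_cons => KyL HK; have [_ KM Kr] := radK.
have KxL : K (x * \prod_(z <- L) z).
  apply: (HK (fun h => K (h * \prod_(z <- L) z)) y) => //.
  - exact: radical_colon.
  - by move=> h Kh; rewrite mulrC; apply: KM.
  - by rewrite inE eqxx.
apply: Kr; apply: (IHL (fun h => K (h * x))); first exact: radical_colon.
  by rewrite mulrC.
move=> K' z radK' KK' Lz; apply: HK => //; last by rewrite inE Lz orbT.
by move=> h Kh; apply: KK'; rewrite mulrC; apply: KM.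
Qed.

Lemma prod_sub_root (F : fieldType) (S : idomainType) (h : {rmorphism F -> S}) N z (u v : S) :
  N.-primitive_root z -> v != 0 -> u ^+ N - v ^+ N = \prod_(i < N) (u - h (z ^+ i) * v).
Proof.
move=> prim_z v0; pose T : {rmorphism S -> {fraction S}} := @FracField.tofrac S.
have T_inj : injective T by move=> x y /eqP; rewrite tofrac_eq => /eqP.
apply: T_inj; rewrite rmorphB !rmorphXn rmorph_prod.
have v0' : T v != 0 by rewrite tofrac_eq0.
pose g : {rmorphism F -> {fraction S}} := T \o h.
have prim_gz : N.-primitive_root (g z) by rewrite fmorph_primitive_root.
have := congr1 (fun p => p.[T u / T v]) (factor_Xn_sub_1 prim_gz).
rewrite hornerD hornerN hornerXn hornerC horner_prod big_mkord => E.
transitivity (((T u / T v) ^+ N - 1) * T v ^+ N).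
  by rewrite mulrBl -exprMn divfK // mul1r.
rewrite -E -[N in T v ^+ N]card_ord -prodr_const -big_split; apply: eq_bigr => i _.
rewrite [LHS]/= hornerXsubC mulrBl divfK // rmorphB rmorphM; congr (_ - _ * _).
by rewrite rmorphXn [RHS]rmorphXn.
Qed.

(** Smoothness outside the origin, expressed without points. Each minor is a product of powers of
    [x_k], [x_j] and of factors [x_j - zeta x_k]. Splitting along these for each [j] in turn leads
    to [x_j = c_j x_k] modulo [K] for all [j]; then [p_a] becomes [(sum c_j^a) x_k^a], whose
    coefficient is nonzero by [unity_sum_eq0]. *)
Lemma minor_radical_var (F : closedFieldType) n a b (R : comNzRingType)
    (pi : {rmorphism mpoly F n -> R}) (K : R -> Prop) (k : nat) :
    [pchar F] =i pred0 -> (0 < a)%N -> (a < b)%N -> (n < pdiv (b - a))%N -> (k < n)%N ->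
    radical_ideal K -> K (pi (psum F n a)) ->
    (forall j, (j < n)%N -> j != k -> K (pi (minor F n a b k j))) ->
  K (pi (mvar F n k)).
Proof.
move=> charF a0 lt_ab nN ltk radK Kp Km.
set N := (b - a)%N in nN *.
have N0 : (0 < N)%N by rewrite subn_gt0.
have [z prim_z] := closed_prim_root_exists charF N0.
pose x j := mvar F n j.
pose C : {rmorphism F -> R} := pi \o mconst F n.
(* Here [l] lists the indices whose ratio to [x_k] is still undetermined and [c] records the ratios
   found; [K] is generalised because each split enlarges it. *)
suff main : forall (l : seq nat) (K : R -> Prop) (c : nat -> F), radical_ideal K ->
      K (pi (psum F n a)) ->
      (forall j, (j < n)%N -> j != k -> K (pi (minor F n a b k j))) ->
      (forall j, (j < n)%N -> j \notin l -> (c j = 0 \/ c j ^+ N = 1) /\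
                 K (pi (x j) - C (c j) * pi (x k))) ->
      c k = 1 -> K (pi (x k)).
  apply: (main (rem k (iota 0 n)) K (fun=> 1)) => // j ltj.
  rewrite mem_rem_uniq ?iota_uniq // inE mem_iota add0n ltj /= !andbT negbK => /eqP ->.
  rewrite expr1n; split; first by right.
  by rewrite !rmorph1 mul1r subrr -(mul0r (pi (psum F n a))); case: radK => _ KM _; apply: KM.
elim=> [|j l IHl] {radK Kp Km} K c radK Kp Km Hc ck.
  have [KD KM _] := radK.
  have KN u : K u -> K (- u) by move=> Ku; rewrite -mulN1r; apply: KM.
  have K0 : K 0 by rewrite -(mul0r (pi (psum F n a))); apply: KM.
  pose s := \sum_(i < n) c i ^+ a.
  have s0 : s != 0.
    apply/eqP => s0.
    have Hw (i : 'I_n) : c i ^+ a = 0 \/ (c i ^+ a) ^+ N = 1.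
      have [[ci|ci] _] := Hc i (ltn_ord i) isT; first by left; rewrite ci expr0n gtn_eqF.
      by right; rewrite exprAC ci expr1n.
    have := unity_sum_eq0 charF N0 nN Hw s0 (Ordinal ltk).
    by rewrite /= ck expr1n => /eqP; rewrite oner_eq0.
  have Ks : K (C s * pi (x k) ^+ a).
    have Ep : pi (psum F n a) = \sum_(i < n) pi (x i) ^+ a.
      by rewrite /psum rmorph_sum; apply: eq_bigr => i _; rewrite rmorphXn.
    have Es : C s * pi (x k) ^+ a = \sum_(i < n) (C (c i) * pi (x k)) ^+ a.
      by rewrite /s rmorph_sum mulr_suml; apply: eq_bigr => i _; rewrite rmorphXn exprMn.
    have -> : C s * pi (x k) ^+ a = pi (psum F n a)
        - \sum_(i < n) (pi (x i) ^+ a - (C (c i) * pi (x k)) ^+ a).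
      by rewrite sumrB -Ep -Es opprB addrCA subrr addr0.
    apply: (KD _ _ Kp); apply: KN; apply: (big_ind K K0 KD) => i _.
    by rewrite subrXX mulrC; exact: (KM _ _ (Hc i (ltn_ord i) isT).2).
  apply: (radical_idealX (k := a) radK).
  have -> : pi (x k) ^+ a = C s^-1 * (C s * pi (x k) ^+ a).
    by rewrite mulrA -rmorphM mulVf // rmorph1 mul1r.
  exact: KM.
have [jl|] := boolP [|| j \in l, j == k | (n <= j)%N].
  apply: (IHl K c) => // i lti il; have [->|neq_ik] := eqVneq i k.
    rewrite ck expr1n rmorph1 mul1r subrr; split; first by right.
    by rewrite -(mul0r (pi (psum F n a))); case: radK => _ KM _; apply: KM.
  apply: Hc => //; rewrite inE negb_or il andbT.
  by apply: contraL jl => /eqP <-; rewrite (negPf il) (negPf neq_ik) leqNgt lti.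
rewrite !negb_or -ltnNge => /and3P[jl neq_jk ltj].
have step (K' : R -> Prop) d : radical_ideal K' -> (forall h, K h -> K' h) ->
    d = 0 \/ d ^+ N = 1 -> K' (pi (x j) - C d * pi (x k)) -> K' (pi (x k)).
  move=> radK' KK' Hd Kd; apply: (IHl K' (fun i => if i == j then d else c i)) => //.
  - exact: KK'.
  - by move=> i lti neq_ik; apply/KK'/Km.
  - move=> i lti il; have [->|neq_ij] := eqVneq i j; first by split.
    have [|Hci Kci] := Hc i lti; first by rewrite inE negb_or neq_ij.
    by split=> //; apply: KK'.
  - by rewrite eq_sym (negPf neq_jk).
(* Since [b - 1 = (a - 1) + N], these are the factors of the minor; a larger radical ideal
   containing one of them contains [x_k], [x_j] or some [x_j - z ^+ i * x_k]. *)
pose L := [:: pi (x k ^+ a.-1), pi (x j ^+ a.-1)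
            & [seq pi (x j - mconst F n (z ^+ i) * x k) | i : 'I_N]].
have xk0 : x k != 0.
  apply/eqP => /(congr1 (meval (GRing.RMorphism.clone F F idfun _) (fun=> 1) n)).
  by rewrite meval_var // rmorph0 => /eqP; rewrite oner_eq0.
apply: (radical_prod_cases (L := L) radK).
  rewrite !big_cons big_image /= -rmorph_prod -(prod_sub_root _ _ prim_z xk0) -!rmorphM.
  have <- : minor F n a b k j = x k ^+ a.-1 * (x j ^+ a.-1 * (x j ^+ N - x k ^+ N)).
    rewrite /minor; have -> : b.-1 = (a.-1 + N)%N by rewrite /N; lia.
    by rewrite !exprD /x; ring.
  exact: Km.
move=> K' y radK' KK'; rewrite !inE => /or3P[/eqP->|/eqP->|/mapP[i _ ->]].
- by rewrite rmorphXn => /(radical_idealX radK').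
- rewrite rmorphXn => /(radical_idealX radK') Kj.
  by apply: (step K' 0) => //; [left | rewrite rmorph0 mul0r subr0].
- rewrite rmorphB rmorphM => Kij; apply: (step K' (z ^+ i)) => //.
  by right; rewrite exprAC (prim_expr_order prim_z) expr1n.
Qed.

(** * Regularity of the last two variables, and primality *)

Lemma psum_last_regular (F : fieldType) n a b (R : comNzRingType)
    (pi : {rmorphism mpoly F n.+3 -> R}) (r : R -> mpoly F n.+3) :
    [pchar F] =i pred0 -> (0 < a)%N -> (0 < b)%N -> odd (a + b) ->
    psum_kernel a b pi -> cancel r pi ->
  forall x, pi (mvar F n.+3 n.+2) * x = 0 -> x = 0.
Proof.
move=> charF a0 b0 oab pi0 rK x; rewrite -(rK x) -rmorphM => /pi0; rewrite mvar_last => H.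
apply/pi0.
apply: (@ideal2_horner_cancel (mpoly F n.+2) _ _ _ 0); last by rewrite polyC0 subr0.
by rewrite !psum_horner0 //; apply: psum_regular_pair.
Qed.

(** Setting the last variable to 0 and cancelling the previous one puts [X.[0]] in the ideal of the
    section. Subtracting from [X] the same combination of [P] and [Q] leaves a multiple of the last
    variable. After both cuts two variables remain, as [psum_regular_pair] requires. *)
Lemma psum_last_two_regular (F : fieldType) n a b (R : comNzRingType)
    (pi : {rmorphism mpoly F n.+4 -> R}) (r : R -> mpoly F n.+4) :
    [pchar F] =i pred0 -> (0 < a)%N -> (0 < b)%N -> odd (a + b) ->
    psum_kernel a b pi -> cancel r pi ->
  forall x y, pi (mvar F n.+4 n.+2) * x = pi (mvar F n.+4 n.+3) * y ->
    exists z, x = pi (mvar F n.+4 n.+3) * z.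
Proof.
move=> charF a0 b0 oab pi0 rK x y.
pose X : {poly mpoly F n.+3} := r x; pose Y : {poly mpoly F n.+3} := r y.
pose P : {poly mpoly F n.+3} := psum F n.+4 a; pose Q : {poly mpoly F n.+3} := psum F n.+4 b.
have xX : x = pi X by rewrite rK.
have yY : y = pi Y by rewrite rK.
rewrite xX yY => /eqP; rewrite -subr_eq0 -!rmorphM -rmorphB mvar_last => /eqP/pi0[u [v E]].
have E0 : mvar F n.+3 n.+2 * X.[0] = (u : {poly mpoly F n.+3}).[0] * psum F n.+3 a
      + (v : {poly mpoly F n.+3}).[0] * psum F n.+3 b.
  have := congr1 (fun g : {poly mpoly F n.+3} => g.[0]) E.
  rewrite hornerD hornerN !hornerM hornerX mul0r subr0 hornerD !hornerM !psum_horner0 //.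
  by rewrite [mvar _ _ _]mvarS // hornerC.
have [u' [v' EX]] : ideal2 (psum F n.+3 a) (psum F n.+3 b) X.[0].
  apply: (@ideal2_horner_cancel (mpoly F n.+2) _ _ _ 0).
    by rewrite !psum_horner0 //; apply: psum_regular_pair.
  by rewrite polyC0 subr0 -mvar_last E0; apply: ideal2_in.
have /factor_theorem[h Eh] : root (X - (u'%:P * P + v'%:P * Q)) 0.
  by rewrite /root hornerD hornerN hornerD !hornerM !hornerC EX !psum_horner0 // subrr.
exists (pi h); apply/eqP; rewrite -subr_eq0 -rmorphM -rmorphB; apply/eqP/pi0.
exists u'%:P, v'%:P; rewrite polyC0 subr0 in Eh.
by rewrite [_ * h]mulrC -Eh opprB addrCA subrr addr0.
Qed.

Lemma odd_gt2_pdiv m : (2 < pdiv m)%N -> odd m.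
Proof.
rewrite ltnNge; apply: contraNT => even_m.
by apply: pdiv_min_dvd; rewrite // dvdn2.
Qed.

Lemma psum_prime (F : closedFieldType) n a b :
    [pchar F] =i pred0 -> (4 <= n)%N -> (0 < a)%N -> (a < b)%N -> (n < pdiv (b - a))%N ->
  forall f g, ideal2 (psum F n a) (psum F n b) (f * g) ->
    ideal2 (psum F n a) (psum F n b) f \/ ideal2 (psum F n a) (psum F n b) g.
Proof.
move=> charF le4n a0 lt_ab nN f g fg.
have b0 : (0 < b)%N by lia.
have oba : odd (b - a) by apply: odd_gt2_pdiv; lia.
have oab : odd (a + b) by lia.
have red := psum_reduced charF le4n a0 lt_ab oba.
have [R [pi [r [pi0 rK gr0]]]] := psum_quotient F n a0 b0.
have redR (x : R) : x * x = 0 -> x = 0.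
  by rewrite -(rK x) -rmorphM => /pi0/red/pi0.
have pfg : pi f * pi g = 0 by rewrite -rmorphM; apply/pi0.
have J0 : ann_sum (pi f) 0 by exists 0, 0; split=> *; rewrite ?mul0r ?addr0.
(* The radical of [Ann(pi f) + Ann(Ann(pi f))]: it contains all minors, hence all variables. *)
pose K h := exists N, ann_sum (pi f) (h ^+ N).
have radK : radical_ideal K.
  exact: (radical_of_ideal (@ann_sumD _ _) (@ann_sumM _ _) J0).
have Kvar k : (k < n)%N -> K (pi (mvar F n k)).
  move=> ltk; apply: (minor_radical_var charF a0 lt_ab nN ltk radK).
    exists 1%N; rewrite expr1; have -> : pi (psum F n a) = 0; last exact: J0.
    by apply/pi0; exists 1, 0; rewrite mul1r mul0r addr0.
  move=> j ltj neq_jk; apply: (ann_sum_minor charF a0 b0 oab ltk ltj _ pi0 rK redR).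
  by rewrite eq_sym.
have idem := graded_idempotent rK gr0.
case: n le4n nN {red} f g fg pi r pi0 rK gr0 redR pfg J0 @K radK Kvar idem => [|[|[|[|n]]]] // _ nN f g fg
  pi r pi0 rK gr0 redR pfg J0 K radK Kvar idem.
have [N JN] := Kvar n.+3 (leqnn _); have [M JM] := Kvar n.+2 (ltnW (leqnn _)).
have s_reg := psum_last_regular charF a0 b0 oab pi0 rK.
have t_reg := psum_last_two_regular charF a0 b0 oab pi0 rK.
by have [/pi0|/pi0] := domain_of_connected s_reg t_reg idem JN JM pfg; [left | right].
Qed.

(** * Ideals given by lists of generators, and the regular sequence *)

Lemma in_ideal0 (R : comNzRingType) (f : R) : in_ideal [::] f <-> f = 0.
Proof.
split=> [[cs [_ ->]]|->]; first by rewrite big_ord0.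
by exists [::]; split=> //; rewrite big_ord0.
Qed.

Lemma in_ideal1 (R : comNzRingType) (p f : R) : in_ideal [:: p] f <-> exists u, f = u * p.
Proof.
split=> [[cs [_ ->]]|[u ->]]; first by rewrite big_ord1; exists cs`_0.
by exists [:: u]; split=> //; rewrite big_ord1.
Qed.

Lemma in_ideal2 (R : comNzRingType) (p q f : R) : in_ideal [:: p; q] f <-> ideal2 p q f.
Proof.
split=> [[cs [_ ->]]|[u [v ->]]].
  by rewrite big_ord_recl big_ord1; exists cs`_0, cs`_1.
by exists [:: u; v]; split=> //; rewrite big_ord_recl big_ord1.
Qed.

Lemma psum_seq_proper (F : fieldType) n (es : seq nat) :
  all (leq 1) es -> ~ in_ideal [seq psum F n e | e <- es] 1.
Proof.
move=> /allP es_gt0 [cs [_ /(congr1 (meval (GRing.RMorphism.clone F F idfun _) (fun=> 0) n))]].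
rewrite rmorph1 rmorph_sum big1 => [/eqP|i _]; first by rewrite oner_eq0.
have lti : (i < size es)%N by rewrite -(size_map (psum F n)).
rewrite rmorphM (nth_map 0%N) // meval_psum big1 ?mulr0 // => j _.
by rewrite expr0n gtn_eqF // es_gt0 ?mem_nth.
Qed.

Theorem theorem3p7 (F : closedFieldType) (hF : [pchar F] =i pred0)
  (n a b : nat) (hn : (4 <= n)%N) (ha : (0 < a)%N) (hab : (a < b)%N)
  (hq : (maxn n a < pdiv (b - a))%N) :
  prime_ideal [:: psum F n a; psum F n b] /\
  (forall c : nat, (0 < c)%N ->
     ~ in_ideal [:: psum F n a; psum F n b] (psum F n c) ->
     regular_seq [:: psum F n a; psum F n b; psum F n c]).
Proof.
have b0 : (0 < b)%N by lia.
have nN : (n < pdiv (b - a))%N by rewrite (leq_ltn_trans _ hq) // leq_maxl.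
have prime := psum_prime hF hn ha hab nN.
split.
  split; first by apply: (@psum_seq_proper F n [:: a; b]); rewrite /= ha b0.
  move=> f g /in_ideal2/prime[] H; [left | right]; exact/in_ideal2.
move=> c c0 pc; split; first by apply: (@psum_seq_proper F n [:: a; b; c]); rewrite /= ha b0 c0.
have oab : odd (a + b) by have := @odd_gt2_pdiv (b - a); lia.
have reg : regular_pair (psum F n a) (psum F n b).
  by case: n hn {hq nN prime pc} => [|[|n]] // _; apply: psum_regular_pair.
(* If [p_a] were 0, the relation [p_a * 1 = p_b * 0] would make 1 a multiple of [p_b]. *)
have pn0 : psum F n a != 0.
  apply/eqP => p0; have [|m [E _]] := reg 1 0; first by rewrite p0 mul0r mulr0.
  by apply: (@psum_proper F n a b ha b0); exists 0, m; rewrite E mul0r add0r mulrC.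
case=> [|[|[|//]]] _ f /=.
- by move=> /in_ideal0/eqP; rewrite mulf_eq0 (negPf pn0) => /eqP f0; apply/in_ideal0.
- move=> /in_ideal1[u E]; apply/in_ideal1; have [|m [_ ->]] := reg u f.
    by rewrite E mulrC.
  by exists m; rewrite mulrC.
(* Modulo a prime ideal, [p_c] is a nonzero divisor because it lies outside it. *)
- by move=> /in_ideal2/prime[] /in_ideal2.
Qed.
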